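(* Let $(M,g,J,\omega)$ be a strictly nearly Kähler manifold of real dimension $6$, where $\omega(X,Y)=g(JX,Y)$. Then every almost complex structure $I\in A^+_{\omega}$ on $M$ is non-integrable.
   Context: All objects are smooth; $M$ is a non-empty manifold. An almost complex structure on $M$ is an endomorphism field $I$ of $TM$ with $I^2=-\mathrm{Id}$; it is integrable if it is induced by a complex manifold structure on $M$, equivalently if its Nijenhuis tensor $N_I(X,Y)=[IX,IY]-I[IX,Y]-I[X,IY]-[X,Y]$ vanishes identically on $M$, and non-integrable otherwise. An almost Hermitian manifold $(M,g,J,\omega)$ consists of a Riemannian metric $g$, an almost complex structure $J$ compatible with $g$ (i.e. $g(JX,JY)=g(X,Y)$), and the fundamental (Kähler) form $\omega(X,Y)=g(JX,Y)$. It is nearly Kähler if $(\nabla_XJ)X=0$ for all tangent vectors $X$, where $\nabla$ is the Levi-Civita connection of $g$. It is strictly nearly Kähler if in addition $\nabla_XJ\neq 0$ for every non-zero tangent vector $X$. $M$ carries the orientation induced by $J$, and $A^+$ denotes the set of all positively oriented almost complex structures on $M$ (those inducing this orientation). The set of almost complex structures positively tamed by $\omega$ is $$A^+_{\omega}=\{I\in A^+:\ \omega(IX,IY)=\omega(X,Y)\ \text{for all } X,Y\in\Gamma(TM);\ \omega(X,IX)>0\ \text{for all tangent vectors } X\neq 0\}.$$ *)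

(* Defs.v *)
From HB Require Import structures.
From mathcomp Require Import all_boot all_order all_algebra.
From mathcomp Require Import all_classical all_reals all_analysis.
Import Order.TTheory GRing.Theory Num.Theory.
Import numFieldNormedType.Exports.

Set Implicit Arguments.
Unset Strict Implicit.
Unset Printing Implicit Defensive.

Local Open Scope classical_set_scope.
Local Open Scope ring_scope.

(* MathComp-Analysis, over an arbitrary model R of the real numbers.
   Tangent vectors are row vectors: an endomorphism A acts by v |-> v *m A,
   so that "A after B" is the matrix B *m A, and a bilinear form G is
   (v, w) |-> v *m G *m w^T. *)

(** * Smooth functions on open subsets of normed spaces *)

Section SmoothFunctions.
Context {R : realType} {V W : normedModType R}.

(* f is of class C^k on the open set A; derivatives at a point of A only
   depend on f near that point, so the values of f outside A are irrelevant. *)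
Fixpoint Ck (k : nat) (A : set V) (f : V -> W) : Prop :=
  if k is k'.+1 then
    (forall x, A x -> differentiable f x) /\
    (forall v : V, Ck k' A (fun x => 'D_v f x))
  else forall x, A x -> {for x, continuous f}.

Definition smooth_on (A : set V) (f : V -> W) : Prop := forall k, Ck k A f.

End SmoothFunctions.

(** * Smooth manifolds *)

Section Charts.
Context {R : realType} {n : nat} {T : topologicalType}.

(* [cmap] and [cinv] are total functions, meaningful on [cdom] and [cim]. *)
Record chart := Chart {
  cdom : set T;
  cim : set 'rV[R]_n;
  cmap : T -> 'rV[R]_n;
  cinv : 'rV[R]_n -> T;
  cdom_open : open cdom;
  cim_open : open cim;
  cmap_im : forall p, cdom p -> cim (cmap p);
  cinv_dom : forall x, cim x -> cdom (cinv x);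
  cmapK : forall p, cdom p -> cinv (cmap p) = p;
  cinvK : forall x, cim x -> cmap (cinv x) = x;
  cmap_continuous : forall p, cdom p -> {for p, continuous cmap};
  cinv_continuous : forall x, cim x -> {for x, continuous cinv}
}.

(* the image under the chart c of the part of U that lies in its domain *)
Definition chart_image (c : chart) (U : set T) : set 'rV[R]_n :=
  [set x | cim c x /\ U (cinv c x)].

Definition transition (c d : chart) : 'rV[R]_n -> 'rV[R]_n :=
  cmap d \o cinv c.

Definition smooth_compatible (c d : chart) : Prop :=
  smooth_on (chart_image c (cdom d)) (transition c d) /\
  smooth_on (chart_image d (cdom c)) (transition d c).

End Charts.

Arguments chart : clear implicits.

(* [chart_at] is not extra geometric structure: it picks some chart around
   each point, and is used only to write the tangent space down (below). *)
Record manifold (R : realType) (n : nat) := Manifold {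
  mcarrier :> topologicalType;
  m_hausdorff : hausdorff_space mcarrier;
  m_second_countable : @second_countable mcarrier;
  atlas : set (chart R n mcarrier);
  atlas_compatible : forall c d, atlas c -> atlas d -> smooth_compatible c d;
  atlas_maximal : forall c,
    (forall d, atlas d -> smooth_compatible c d) -> atlas c;
  chart_at : mcarrier -> chart R n mcarrier;
  chart_at_atlas : forall p, atlas (chart_at p);
  chart_at_dom : forall p, cdom (chart_at p) p
}.

(** * Tensor fields

   The tangent space T_pM is R^n, a tangent vector at p being represented by
   its components in the chart [chart_at p].  A field of vectors,
   endomorphisms or bilinear forms thus assigns to each p a row vector or a
   matrix; its components in an arbitrary chart c are recovered through the
   Jacobian of the transition from [chart_at p] to c, and the field is smooth
   when its components in every chart of the atlas are. *)

Section Tensors.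
Context {R : realType} {n : nat} {M : manifold R n}.

Definition vfield := M -> 'rV[R]_n.
Definition mxfield := M -> 'M[R]_n.

(* v *m chg c p are the components in the chart c of v in T_pM. *)
Definition chg (c : chart R n M) (p : M) : 'M[R]_n :=
  jacobian (transition (chart_at p) c) (cmap (chart_at p) p).

Definition vec_in (c : chart R n M) (X : vfield) (x : 'rV[R]_n) : 'rV[R]_n :=
  X (cinv c x) *m chg c (cinv c x).

Definition endo_in (c : chart R n M) (A : mxfield) (x : 'rV[R]_n) : 'M[R]_n :=
  invmx (chg c (cinv c x)) *m A (cinv c x) *m chg c (cinv c x).

Definition form_in (c : chart R n M) (G : mxfield) (x : 'rV[R]_n) : 'M[R]_n :=
  invmx (chg c (cinv c x)) *m G (cinv c x) *m (invmx (chg c (cinv c x)))^T.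

Definition smooth_fun (U : set M) (f : M -> R) : Prop :=
  forall c, atlas c -> smooth_on (chart_image c U) (f \o cinv c).

(* X is a smooth vector field on the open set U. *)
Definition smooth_vec (U : set M) (X : vfield) : Prop :=
  forall c, atlas c -> smooth_on (chart_image c U) (vec_in c X).

Definition smooth_endo (A : mxfield) : Prop :=
  forall c, atlas c -> smooth_on (cim c) (endo_in c A).

Definition smooth_form (G : mxfield) : Prop :=
  forall c, atlas c -> smooth_on (cim c) (form_in c G).

Definition endo_app (A : mxfield) (X : vfield) : vfield :=
  fun q => X q *m A q.

Definition bil (G : 'M[R]_n) (v w : 'rV[R]_n) : R := (v *m G *m w^T) 0 0.

(* the derivative of f at p along the tangent vector v in T_pM *)
Definition dir_der (f : M -> R) (p : M) (v : 'rV[R]_n) : R :=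
  'D_v (f \o cinv (chart_at p)) (cmap (chart_at p) p).

Definition lie_bracket (X Y : vfield) : vfield := fun p =>
  let c := chart_at p in
  'D_(X p) (vec_in c Y) (cmap c p) - 'D_(Y p) (vec_in c X) (cmap c p).

End Tensors.

Arguments vfield {R n} M.
Arguments mxfield {R n} M.

(** * Almost complex structures and integrability *)

Section AlmostComplex.
Context {R : realType} {n : nat} {M : manifold R n}.
Implicit Types (I J : mxfield M) (X Y : vfield M).

Definition almost_complex I : Prop :=
  smooth_endo I /\ forall p, I p *m I p = - 1%:M.

(* Multiplication by i on C^(n/2) with real coordinates
   (Re z_0, Im z_0, Re z_1, Im z_1, ...): the basis vector e_(2k) is sent to
   e_(2k+1), and e_(2k+1) to - e_(2k). *)
Definition std_cplx : 'M[R]_n :=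
  \matrix_(i, j) ((~~ odd i && (j == i.+1 :> nat))%:R
                  - (~~ odd j && (i == j.+1 :> nat))%:R).

Definition nijenhuis I X Y : vfield M := fun p =>
  lie_bracket (endo_app I X) (endo_app I Y) p
  - endo_app I (lie_bracket (endo_app I X) Y) p
  - endo_app I (lie_bracket X (endo_app I Y)) p
  - lie_bracket X Y p.

(* Vector fields on open subsets are used: they realise every tangent vector,
   and N_I is a tensor. *)
Definition nijenhuis_vanishes I : Prop :=
  forall (U : set M) X Y, open U -> smooth_vec U X -> smooth_vec U Y ->
  forall p, U p -> nijenhuis I X Y p = 0.

(* An atlas of complex charts of M, identifying C^(n/2) with R^n as in
   [std_cplx]; the transitions are holomorphic, i.e. satisfy the
   Cauchy-Riemann equations. *)
Definition complex_atlas (A : set (chart R n M)) : Prop :=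
  [/\ A `<=` atlas (m := M),
      (forall p, exists2 c, A c & cdom c p) &
      forall c d, A c -> A d -> forall x, chart_image c (cdom d) x ->
        std_cplx *m jacobian (transition c d) x
        = jacobian (transition c d) x *m std_cplx].

Definition induced_by_complex_manifold I : Prop :=
  exists2 A, complex_atlas A &
    forall c, A c -> forall x, cim c x -> endo_in c I x = std_cplx.

(* The two conditions are equivalent by the Newlander-Nirenberg theorem; by
   taking their disjunction, being non-integrable denies both of them. *)
Definition integrable_acs I : Prop :=
  induced_by_complex_manifold I \/ nijenhuis_vanishes I.

(* B is a basis of T_pM (its rows) of the form (e_1, I e_1, e_2, I e_2, ...),
   that is, a complex-linear isomorphism from C^(n/2) to (T_pM, I_p). *)
Definition adapted_basis I (p : M) (B : 'M[R]_n) : Prop :=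
  B \in unitmx /\ B *m I p = std_cplx *m B.

(* The orientation induced by I is the one making the adapted bases positive. *)
Definition same_orientation I J : Prop :=
  forall p B B', adapted_basis I p B -> adapted_basis J p B' ->
  0 < \det B * \det B'.

End AlmostComplex.

(** * Riemannian metrics, the Levi-Civita connection, nearly Kähler manifolds *)

Section NearlyKahler.
Context {R : realType} {n : nat} {M : manifold R n}.
Implicit Types (g I J : mxfield M) (X Y Z : vfield M) (U : set M).

Definition riemannian g : Prop :=
  [/\ smooth_form g,
      forall p v w, bil (g p) v w = bil (g p) w v &
      forall p v, v != 0 -> 0 < bil (g p) v v].

Definition kahler_form g J (p : M) (v w : 'rV[R]_n) : R :=
  bil (g p) (v *m J p) w.

Definition almost_hermitian g J : Prop :=
  [/\ riemannian g, almost_complex J &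
      forall p v w, bil (g p) (v *m J p) (w *m J p) = bil (g p) v w].

(* An affine connection, acting on the vector fields of every open subset U;
   since fields are total functions, [conn_local] says that the restriction of
   nabla X Y to U only depends on those of X and Y. *)
Record affine_connection (nabla : vfield M -> vfield M -> vfield M) : Prop := {
  conn_local : forall U X X' Y Y', open U ->
    smooth_vec U X -> smooth_vec U Y ->
    (forall p, U p -> X p = X' p) -> (forall p, U p -> Y p = Y' p) ->
    forall p, U p -> nabla X Y p = nabla X' Y' p;
  conn_smooth : forall U X Y, open U -> smooth_vec U X -> smooth_vec U Y ->
    smooth_vec U (nabla X Y);
  conn_linear : forall U (f : M -> R) X X' Y, open U -> smooth_fun U f ->
    smooth_vec U X -> smooth_vec U X' -> smooth_vec U Y ->
    forall p, U p ->
      nabla (fun q => f q *: X q + X' q) Y p = f p *: nabla X Y p + nabla X' Y p;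
  conn_additive : forall U X Y Y', open U ->
    smooth_vec U X -> smooth_vec U Y -> smooth_vec U Y' ->
    forall p, U p ->
      nabla X (fun q => Y q + Y' q) p = nabla X Y p + nabla X Y' p;
  conn_leibniz : forall U (f : M -> R) X Y, open U -> smooth_fun U f ->
    smooth_vec U X -> smooth_vec U Y ->
    forall p, U p ->
      nabla X (fun q => f q *: Y q) p
      = dir_der f p (X p) *: Y p + f p *: nabla X Y p
}.

Definition torsion_free (nabla : vfield M -> vfield M -> vfield M) : Prop :=
  forall U X Y, open U -> smooth_vec U X -> smooth_vec U Y ->
  forall p, U p -> nabla X Y p - nabla Y X p = lie_bracket X Y p.

Definition metric_connection g (nabla : vfield M -> vfield M -> vfield M) :
    Prop :=
  forall U X Y Z, open U -> smooth_vec U X -> smooth_vec U Y -> smooth_vec U Z ->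
  forall p, U p ->
    dir_der (fun q => bil (g q) (Y q) (Z q)) p (X p)
    = bil (g p) (nabla X Y p) (Z p) + bil (g p) (Y p) (nabla X Z p).

Definition levi_civita g (nabla : vfield M -> vfield M -> vfield M) : Prop :=
  [/\ affine_connection nabla, torsion_free nabla & metric_connection g nabla].

(* (nabla_X J) Y *)
Definition cov_der_endo (nabla : vfield M -> vfield M -> vfield M) J X Y :
    vfield M :=
  fun p => nabla X (endo_app J Y) p - endo_app J (nabla X Y) p.

(* (nabla_X J) X = 0 for every X *)
Definition nearly_kahler_cond (nabla : vfield M -> vfield M -> vfield M) J :
    Prop :=
  forall U X, open U -> smooth_vec U X ->
  forall p, U p -> cov_der_endo nabla J X X p = 0.

(* For v in T_pM, nabla_v J is nonzero when (nabla_X J) Y is nonzero at p for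
   some fields X, Y near p with X_p = v; this value only depends on v and Y_p. *)
Definition strictness_cond (nabla : vfield M -> vfield M -> vfield M) J :
    Prop :=
  forall p (v : 'rV[R]_n), v != 0 ->
  exists U X Y, [/\ open U, U p, smooth_vec U X, smooth_vec U Y &
                    X p = v /\ cov_der_endo nabla J X Y p != 0].

Definition strictly_nearly_kahler g J : Prop :=
  almost_hermitian g J /\
  exists nabla, [/\ levi_civita g nabla, nearly_kahler_cond nabla J &
                    strictness_cond nabla J].

(* A^+_omega, for omega the Kähler form of (g, J) and the orientation induced
   by J *)
Definition A_plus_omega g J : set (mxfield M) :=
  [set I | [/\ almost_complex I, same_orientation I J,
     forall p v w,
       kahler_form g J p (v *m I p) (w *m I p) = kahler_form g J p v w &
     forall p v, v != 0 -> 0 < kahler_form g J p v (v *m I p)]].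

End NearlyKahler.

(* Main.v *)
From HB Require Import structures.
Require Import Defs.
From mathcomp Require Import all_boot all_order all_algebra.
From mathcomp Require Import all_classical all_reals all_analysis.
From mathcomp Require Import ring lra.
Import Order.TTheory GRing.Theory Num.Theory.
Import numFieldNormedType.Exports.

Set Implicit Arguments.
Unset Strict Implicit.
Unset Printing Implicit Defensive.

Local Open Scope classical_set_scope.
Local Open Scope ring_scope.

(** The obstruction is the value of the three-form d omega at a single point p,
   and it is purely algebraic there.

   On the nearly Kähler side, put T(X, Y, Z) = g((nabla_X J) Y, Z), which is
   (nabla_X omega)(Y, Z).  It is skew in Y and Z because J is g-orthogonal, and
   skew in X and Y because (nabla_X J) X = 0; so it is alternating.  Since nabla
   is torsion-free, d omega is the cyclic sum of T, that is
   d omega = 3 T ([nabla_omega_ext_d]).  As J^2 = -1, nabla_X J anticommutes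
   with J, so T(X, JY, JZ) = - T(X, Y, Z): the form d omega is of type
   (3,0) + (0,3) for J ([nearly_kahler_ext_d_type30]).  Strictness makes it
   nonzero at p ([strictly_nearly_kahler_ext_d_neq0]).

   On the side of I, omega is I-invariant.  If the Nijenhuis tensor of I is zero
   at p, then d omega is of type (2,1) + (1,2) for I ([ext_d_type21]).

   These two conditions are incompatible when I is tamed by omega
   ([type30_type21_eq0]).  Write I as P followed by J; invariance and taming say
   that P is self-adjoint and positive for g_p.  For D = d omega at p, the two
   type conditions together become
     D(x, y, z) + D(Px, Py, z) + D(Px, y, Pz) + D(x, Py, Pz) = 0.
   The operators of the form P (x) P (x) 1 on trilinear forms are positive, so
   the left-hand side is the image of D under a positive definite operator, and
   D = 0 ([trilinear_positive0]).

   All computations at p are made in the chart [chart_at p], in which the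
   Jacobian factor at p itself is the identity.  Both readings of integrability
   are reduced to the vanishing of the coordinate expression [nijenhuis_coord]:
   for the Nijenhuis tensor by evaluating it on coordinate fields, and for an
   atlas of complex charts by the symmetry of the second derivatives of a
   transition map ([complex_nijenhuis_coord]). *)

(** * Calculus of matrix-valued smooth functions *)

Section Differentiability.
Context {R : realType} {V : normedModType R}.

(** The differential of f at x satisfies the first-order expansion of g at x. *)
Lemma near_eq_differentiable (W : normedModType R) (f g : V -> W) (x : V) :
  (\forall y \near x, f y = g y) -> differentiable f x -> differentiable g x.
Proof.
move=> fg dfx.
have fgx : f x = g x by exact: nbhs_singleton fg.
have df := diff_locally dfx.
have dg : g \o shift x = cst (g x) + 'd f x +o_ 0 id.
  apply/eqaddoP => e e0.
  move/eqaddoP : df => /(_ e e0); rewrite fgx.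
  apply: filter_app; near=> h; rewrite /= !fctE /= => le_f.
  suff -> : g (h + x) = f (h + x) by [].
  near: h.
  have : \forall y \near x, g y = f y by apply: filterS fg.
  by rewrite (near_shift 0 x) subr0; apply: filterS => y.
apply/diff_locallyP.
have -> : 'd g x = 'd f x :> (V -> W).
  by apply: diff_unique => //; exact: diff_continuous.
by split => //; exact: diff_continuous.
Unshelve. all: by end_near. Qed.

Lemma differentiable_mxP m n (f : V -> 'M[R]_(m, n)) (x : V) :
  differentiable f x <-> forall i j, differentiable (fun y => f y i j : R) x.
Proof.
split=> [df i j|df].
  exact: (differentiable_comp df (differentiable_coord _ i j)).
have -> : f = \sum_i \sum_j (fun y => f y i j *: delta_mx i j).
  apply/funext => y; rewrite {1}[f y]matrix_sum_delta.
  rewrite fct_sumE; apply: eq_bigr => i _.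
  by rewrite fct_sumE.
apply: differentiable_sum => i; apply: differentiable_sum => j.
exact: differentiableZl.
Qed.

Lemma derive_mxE m n (f : V -> 'M[R]_(m, n)) (x v : V) i j :
  differentiable f x -> ('D_v f x) i j = 'D_v (fun y => f y i j : R) x.
Proof.
by move=> df; rewrite derive_mx ?mxE//; exact: diff_derivable.
Qed.

Lemma differentiable_mulmx m n p (f : V -> 'M[R]_(m, n)) (g : V -> 'M[R]_(n, p))
    (x : V) :
  differentiable f x -> differentiable g x ->
  differentiable (fun y => f y *m g y) x.
Proof.
move=> /differentiable_mxP df /differentiable_mxP dg.
apply/differentiable_mxP => i j.
have -> : (fun y => (f y *m g y) i j)
    = \sum_k ((fun y => f y i k) * (fun y => g y k j)).
  by apply/funext => y; rewrite mxE fct_sumE.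
by apply: differentiable_sum => k; exact: differentiableM.
Qed.

Lemma derive_mulmx m n p (f : V -> 'M[R]_(m, n)) (g : V -> 'M[R]_(n, p))
    (x v : V) :
  differentiable f x -> differentiable g x ->
  'D_v (fun y => f y *m g y) x = 'D_v f x *m g x + f x *m 'D_v g x.
Proof.
move=> df dg; apply/matrixP => i j.
rewrite derive_mxE; last exact: differentiable_mulmx.
rewrite !mxE.
have -> : (fun y => (f y *m g y) i j)
    = \sum_k ((fun y => f y i k) * (fun y => g y k j)).
  by apply/funext => y; rewrite mxE fct_sumE.
have df' i' k : derivable (fun y => f y i' k : R) x v.
  by apply: diff_derivable; move/differentiable_mxP: df.
have dg' k j' : derivable (fun y => g y k j' : R) x v.
  by apply: diff_derivable; move/differentiable_mxP: dg.
rewrite derive_sum; last by move=> k; exact: derivableM.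
rewrite -big_split; apply: eq_bigr => k _ /=.
rewrite deriveM// !derive_mxE// addrC; congr (_ + _).
by rewrite /GRing.scale /= mulrC.
Qed.

Lemma differentiable_trmx m n (f : V -> 'M[R]_(m, n)) (x : V) :
  differentiable f x -> differentiable (fun y => (f y)^T) x.
Proof.
move=> /differentiable_mxP df; apply/differentiable_mxP => i j.
by under eq_fun do rewrite mxE.
Qed.

Lemma derive_trmx m n (f : V -> 'M[R]_(m, n)) (x v : V) :
  differentiable f x -> 'D_v (fun y => (f y)^T) x = ('D_v f x)^T.
Proof.
move=> df; apply/matrixP => i j.
rewrite derive_mxE; last exact: differentiable_trmx.
by rewrite mxE derive_mxE//; under eq_fun do rewrite mxE.
Qed.

Lemma derive_dir_linear (W : normedModType R) (f : V -> W) (x : V) :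
  differentiable f x -> linear (fun v => 'D_v f x).
Proof. by move=> df a u v; rewrite !deriveE// linearP. Qed.

End Differentiability.

Section Smooth.
Context {R : realType} {V : normedModType R}.

Lemma smooth_continuous (W : normedModType R) (A : set V) (f : V -> W) x :
  smooth_on A f -> A x -> {for x, continuous f}.
Proof. by move=> sf; exact: (sf 0%N). Qed.

Lemma smooth_differentiable (W : normedModType R) (A : set V) (f : V -> W) x :
  smooth_on A f -> A x -> differentiable f x.
Proof. by move=> sf; have [df _] := sf 1%N; exact: df. Qed.

Lemma smooth_derive (W : normedModType R) (A : set V) (f : V -> W) (v : V) :
  smooth_on A f -> smooth_on A (fun x => 'D_v f x).
Proof. by move=> sf k; have [_] := sf k.+1; apply. Qed.

(** At the last stage differentiability gives the continuity that the case k = 0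
   asks for. *)
Lemma Ck_le (W : normedModType R) k (A : set V) (f : V -> W) :
  Ck k.+1 A f -> Ck k A f.
Proof.
elim: k f => [|k IHk] f /= [df Df].
  by move=> x Ax; apply: differentiable_continuous; exact: df.
by split=> // v; apply: IHk; exact: Df.
Qed.

Lemma Ck_sub (W : normedModType R) k (A B : set V) (f : V -> W) :
  A `<=` B -> Ck k B f -> Ck k A f.
Proof.
move=> AB; elim: k f => [|k IHk] f /=; first by move=> Bf x /AB; exact: Bf.
by move=> [df Df]; split=> [x /AB|v]; [exact: df|exact: IHk].
Qed.

Lemma smooth_on_sub (W : normedModType R) (A B : set V) (f : V -> W) :
  A `<=` B -> smooth_on B f -> smooth_on A f.
Proof. by move=> AB sf k; apply: (Ck_sub AB); exact: sf. Qed.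

Lemma near_open (A : set V) x (P : V -> Prop) : open A -> A x ->
  (forall y, A y -> P y) -> \forall y \near x, P y.
Proof. by move=> oA Ax AP; apply: filterS AP _; exact: open_nbhs_nbhs. Qed.

(** The values outside the open set A do not matter: germs at points of A
   determine the derivatives. *)
Lemma Ck_eq (W : normedModType R) k (A : set V) (f g : V -> W) :
  open A -> (forall x, A x -> f x = g x) -> Ck k A f -> Ck k A g.
Proof.
move=> oA; elim: k f g => [|k IHk] f g fg /=.
  move=> cf x Ax; rewrite /prop_for /continuous_at -(fg _ Ax).
  apply: cvg_trans (cf x Ax); apply: near_eq_cvg.
  exact: near_open oA Ax _.
move=> [df Df]; split=> [x Ax|v].
  apply: near_eq_differentiable (df x Ax); exact: near_open oA Ax _.
apply: IHk (Df v) => x Ax; apply: near_eq_derive; exact: near_open oA Ax _.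
Qed.

Lemma smooth_on_eq (W : normedModType R) (A : set V) (f g : V -> W) :
  open A -> (forall x, A x -> f x = g x) -> smooth_on A f -> smooth_on A g.
Proof. by move=> oA fg sf k; exact: Ck_eq oA fg (sf k). Qed.

Lemma smooth_cst (W : normedModType R) (A : set V) (a : W) :
  smooth_on A (fun=> a).
Proof.
move=> k; elim: k a => [|k IHk] a /=.
  by move=> x _; exact: cst_continuous.
split=> [x _|v]; first exact: differentiable_cst.
have -> : (fun x : V => 'D_v (fun=> a) x) = (fun=> 0).
  by apply/funext => x; exact: derive_cst.
exact: IHk.
Qed.

Lemma Ck_add (W : normedModType R) k (A : set V) (f g : V -> W) : open A ->
  Ck k A f -> Ck k A g -> Ck k A (fun x => f x + g x).
Proof.
move=> oA; elim: k f g => [|k IHk] f g /=.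
  by move=> cf cg x Ax; apply: cvgD; [exact: cf|exact: cg].
move=> [df Df] [dg Dg]; split=> [x Ax|v].
  by apply: differentiableD; [exact: df|exact: dg].
apply: Ck_eq (IHk _ _ (Df v) (Dg v)) => // x Ax; apply/esym/deriveD.
  exact/diff_derivable/df.
exact/diff_derivable/dg.
Qed.

Lemma Ck_sum (W : normedModType R) k (A : set V) m (f : 'I_m -> V -> W) :
  open A -> (forall i, Ck k A (f i)) -> Ck k A (fun x => \sum_i f i x).
Proof.
move=> oA; elim: m f => [|m IHm] f sf.
  by under eq_fun do rewrite big_ord0; exact: (@smooth_cst _ A 0).
by under eq_fun do rewrite big_ord_recl; apply: Ck_add => //; exact: IHm.
Qed.

(** Continuity on pairs is read off the differentiability of a product of
   differentiable functions, applied to the two projections. *)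
Lemma mulmx_continuous m n p (M : 'M[R]_(m, n)) (N : 'M[R]_(n, p)) :
  {for (M, N), continuous
     (fun MN : 'M[R]_(m, n) * 'M[R]_(n, p) => MN.1 *m MN.2)}.
Proof.
apply: differentiable_continuous.
apply: differentiable_mulmx; apply: linear_differentiable => x.
  exact: cvg_fst.
exact: cvg_snd.
Qed.

Lemma Ck_mulmx k (A : set V) m n p (f : V -> 'M[R]_(m, n))
    (g : V -> 'M[R]_(n, p)) : open A ->
  Ck k A f -> Ck k A g -> Ck k A (fun x => f x *m g x).
Proof.
move=> oA; elim: k f g => [|k IHk] f g.
  move=> /= cf cg x Ax; apply: continuous2_cvg; last 2 first.
  - exact: cf.
  - exact: cg.
  - exact: mulmx_continuous.
move=> /[dup] /Ck_le sf [df Df] /[dup] /Ck_le sg [dg Dg]; split=> [x Ax|v].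
  by apply: differentiable_mulmx; [exact: df|exact: dg].
apply: Ck_eq (Ck_add oA (IHk _ _ (Df v) sg) (IHk _ _ sf (Dg v))) => // x Ax.
by apply/esym/derive_mulmx; [exact: df|exact: dg].
Qed.

Lemma smooth_add (W : normedModType R) (A : set V) (f g : V -> W) : open A ->
  smooth_on A f -> smooth_on A g -> smooth_on A (fun x => f x + g x).
Proof. by move=> oA sf sg k; exact: Ck_add. Qed.

Lemma smooth_mulmx (A : set V) m n p (f : V -> 'M[R]_(m, n))
    (g : V -> 'M[R]_(n, p)) : open A ->
  smooth_on A f -> smooth_on A g -> smooth_on A (fun x => f x *m g x).
Proof. by move=> oA sf sg k; exact: Ck_mulmx. Qed.

End Smooth.

Section SmoothRow.
Context {R : realType}.

Lemma derive_comp (U V W : normedModType R) (g : V -> U) (f : U -> W)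
    (x v : V) :
  differentiable g x -> differentiable f (g x) ->
  'D_v (f \o g) x = 'D_('D_v g x) f (g x).
Proof.
move=> dg df; rewrite deriveE; last exact: differentiable_comp.
by rewrite diff_comp//= !deriveE.
Qed.

Lemma row_mul_jacobian m n (f : 'rV[R]_m -> 'rV[R]_n) (x v : 'rV[R]_m) :
  differentiable f x -> v *m jacobian f x = 'D_v f x.
Proof. by move=> df; rewrite deriveEjacobian. Qed.

(** By induction on k through the chain rule
   D_v (f o g) = sum_i (D_v g)_i (D_i f) o g, in which each D_i f is again
   smooth and the scalar factor is written as a 1 x 1 matrix to reuse the product
   rule. *)
Lemma smooth_comp (V : normedModType R) m n (A : set V) (B : set 'rV[R]_m)
    (g : V -> 'rV[R]_m) (f : 'rV[R]_m -> 'rV[R]_n) : open A ->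
  (forall x, A x -> B (g x)) ->
  smooth_on A g -> smooth_on B f -> smooth_on A (f \o g).
Proof.
move=> oA gAB sg sf k; elim: k f sf => [|k IHk] f sf.
  move=> x Ax; apply: continuous_comp; first exact: smooth_continuous sg Ax.
  exact: smooth_continuous sf (gAB _ Ax).
split=> [x Ax|v].
  apply: differentiable_comp; first exact: smooth_differentiable sg Ax.
  exact: smooth_differentiable sf (gAB _ Ax).
have Dfg i : Ck k A (fun x => 'D_v g x *m (delta_mx i 0 : 'cV_m)
                            *m ('D_(delta_mx 0 i) f \o g) x).
  apply: Ck_mulmx => //; last exact/IHk/smooth_derive.
  by apply: (smooth_mulmx oA _ _ k); [exact: smooth_derive|exact: smooth_cst].
apply: Ck_eq (Ck_sum oA Dfg) => // x Ax.
have dfx := smooth_differentiable sf (gAB _ Ax).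
rewrite [RHS]derive_comp//; last exact: smooth_differentiable sg Ax.
rewrite [RHS]deriveE// [X in 'd f (g x) X]row_sum_delta linear_sum.
apply: eq_bigr => i _ /=; rewrite linearZ /= -colE -deriveE//.
by rewrite [col i _]mx11_scalar mul_scalar_mx !mxE.
Qed.

Lemma smooth_jacobian m n (A : set 'rV[R]_m) (f : 'rV[R]_m -> 'rV[R]_n) :
  open A -> smooth_on A f -> smooth_on A (jacobian f).
Proof.
move=> oA sf k.
have Df i : Ck k A (fun x => (delta_mx i 0 : 'cV_m) *m 'D_(delta_mx 0 i) f x).
  by apply: Ck_mulmx => //; [exact: smooth_cst|exact: smooth_derive].
apply: Ck_eq (Ck_sum oA Df) => // x Ax; apply/row_matrixP => i.
rewrite !rowE row_mul_jacobian; last exact: smooth_differentiable sf Ax.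
rewrite mulmx_sumr (bigD1 i)//= big1 => [|j ji].
  by rewrite addr0 mulmxA mul_delta_mx -[RHS]mul1mx; congr (_ *m _);
     apply/matrixP => a b; rewrite !ord1 !mxE !eqxx.
by rewrite mulmxA mul_delta_mx_0 ?mul0mx// eq_sym.
Qed.

Lemma derive_jacobian m n (A : set 'rV[R]_m) (f : 'rV[R]_m -> 'rV[R]_n)
   (x u v : 'rV[R]_m) : open A -> smooth_on A f -> A x ->
  u *m 'D_v (jacobian f) x = 'D_v ('D_u f) x.
Proof.
move=> oA sf Ax.
have dJ := smooth_differentiable (smooth_jacobian oA sf) Ax.
have -> : 'D_v ('D_u f) x = 'D_v (fun y => u *m jacobian f y) x.
  apply: near_eq_derive; apply: near_open oA Ax _ => y Ay.
  by rewrite row_mul_jacobian//; exact: smooth_differentiable sf Ay.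
by rewrite (@derive_mulmx _ _ _ _ _ (fun=> u)) ?derive_cst ?mul0mx ?add0r//.
Qed.

End SmoothRow.

(** * Symmetry of second derivatives *)

Section Schwarz.
Context {R : realType} {V : normedModType R}.

Lemma is_derive_line (W : normedModType R) (f : V -> W) (w u : V) (s : R) :
  differentiable f (w + s *: u) ->
  is_derive s 1 (fun r : R => f (w + r *: u)) ('D_u f (w + s *: u)).
Proof.
move=> df.
have dl : is_diff s (fun r : R => w + r *: u) ( *:%R^~ u).
  have -> : *:%R^~ u = 0 + *:%R^~ u :> (R -> V) by rewrite add0r.
  exact: is_diffD.
have dl' : differentiable (fun r : R => w + r *: u) s by [].
have dfl : differentiable (f \o (fun r : R => w + r *: u)) s.
  exact: differentiable_comp.
apply: DeriveDef; first exact: diff_derivable dfl.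
rewrite (derive_comp _ dl' df).
by congr ('D__ f _); rewrite deriveE// diff_val scale1r.
Qed.

Lemma MVT_line (f : V -> R) (w u : V) (t : R) : 0 < t ->
  (forall s, 0 <= s <= t -> differentiable f (w + s *: u)) ->
  exists2 c, 0 <= c <= t & f (w + t *: u) - f w = t * 'D_u f (w + c *: u).
Proof.
move=> t0 df.
have dfl s : 0 <= s <= t ->
    is_derive s 1 (fun r : R => f (w + r *: u)) ('D_u f (w + s *: u)).
  by move=> s0t; apply: is_derive_line; exact: df.
have [s|s|c] := @MVT_segment R (fun r : R => f (w + r *: u))
    (fun s => 'D_u f (w + s *: u)) 0 t (ltW t0).
- by rewrite in_itv /= => /andP[s0 st]; apply: dfl; rewrite !ltW.
- move: s; apply: derivable_within_continuous => s; rewrite in_itv /= => s0t.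
  by have [] := dfl s s0t.
- rewrite in_itv /= scale0r addr0 subr0 => c0t ->; exists c => //.
  by rewrite mulrC.
Qed.

(** Two applications of the mean value theorem, along u to
   w |-> f (w + t v) - f w, then along v to D_u f.  The left-hand side is
   symmetric in u and v, hence the symmetry of second derivatives. *)
Lemma second_difference (f : V -> R) (A : set V) (x u v : V) (t : R) :
  0 < t -> smooth_on A f ->
  (forall r s : R, 0 <= r <= t -> 0 <= s <= t -> A (x + r *: u + s *: v)) ->
  exists r s, [/\ 0 <= r <= t, 0 <= s <= t &
    f (x + t *: u + t *: v) - f (x + t *: u) - f (x + t *: v) + f x
    = t * (t * 'D_v ('D_u f) (x + r *: u + s *: v))].
Proof.
move=> t0 sf Axt.
have t0t : 0 <= t <= t by rewrite ltW ?lexx.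
have z0t : (0 : R) <= 0 <= t by rewrite lexx ltW.
have df (r s : R) : 0 <= r <= t -> 0 <= s <= t ->
    differentiable f (x + r *: u + s *: v).
  by move=> r0 s0; exact: smooth_differentiable sf (Axt _ _ r0 s0).
pose h w := f (w + t *: v) - f w.
have dh (s : R) : 0 <= s <= t ->
   differentiable (fun w => f (w + t *: v)) (x + s *: u).
  move=> s0t.
  have := @differentiable_comp R _ _ _ (fun w => w + t *: v) f (x + s *: u).
  by apply => //; exact: df.
have df0 (s : R) : 0 <= s <= t -> differentiable f (x + s *: u).
  by move=> s0t; have := df s 0 s0t z0t; rewrite scale0r addr0.
have [s s0t|r r0t] := @MVT_line h x u t t0.
  by apply: differentiableB; [exact: dh|exact: df0].
have Dh : 'D_u h (x + r *: u)
    = 'D_u f (x + r *: u + t *: v) - 'D_u f (x + r *: u).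
  rewrite (deriveB (diff_derivable (dh _ r0t)) (diff_derivable (df0 _ r0t))).
  congr (_ - _).
  have -> : (fun w => f (w + t *: v)) = f \o (fun w => w + t *: v) by [].
  rewrite derive_comp//; last exact: df.
  congr ('D__ f _); rewrite deriveE// diff_val; exact: addr0.
rewrite Dh => hE.
have [s s0t|s s0t E] := @MVT_line ('D_u f) (x + r *: u) v t t0.
  exact: smooth_differentiable (smooth_derive _ sf) (Axt _ _ r0t s0t).
exists r, s; split => //.
by rewrite -E -hE /h; ring.
Qed.

Lemma near_parallelogram (A : set V) (x u v : V) : nbhs x A ->
  exists2 t : R, 0 < t &
    forall r s : R, 0 <= r <= t -> 0 <= s <= t -> A (x + r *: u + s *: v).
Proof.
move=> /nbhs_ballP[e /= e0 xA]; exists (e / (`|u| + `|v| + 1)).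
  by rewrite divr_gt0// ltr_wpDl// addr_ge0.
set t := e / _ => r s /andP[r0 rt] /andP[s0 st]; apply: xA.
rewrite -ball_normE /ball_ /= -addrA opprD addNKr.
have k0 : 0 < `|u| + `|v| + 1 by rewrite ltr_wpDl// addr_ge0.
have te : t * (`|u| + `|v|) < e.
  rewrite /t mulrAC ltr_pdivrMr// ltr_pM2l// ltrDl//.
apply: le_lt_trans te; rewrite normrN.
rewrite (le_trans (ler_normD _ _))// !normrZ mulrDr !ger0_norm//.
by rewrite lerD// ler_wpM2r.
Qed.

Lemma dist_le_halves (a b c e : R) :
  `|b - c| < e / 2 -> `|a - c| < e / 2 -> `|b - a| <= e.
Proof.
move=> bc ac; rewrite (le_trans (ler_distD c _ _))// (splitr e).
by rewrite (distrC c) lerD// ltW.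
Qed.

(** The two orders of differentiation, at nearby points, are both equal to the
   second difference over a small parallelogram divided by t^2; continuity at x
   concludes. *)
Lemma second_derivative_symmetric_scalar (f : V -> R) (A : set V) (x u v : V) :
  open A -> smooth_on A f -> A x -> 'D_v ('D_u f) x = 'D_u ('D_v f) x.
Proof.
move=> oA sf Ax.
apply/eqP; rewrite -subr_eq0 -normr_le0; apply/ler_addgt0Pl => e e0.
rewrite addr0.
pose e2 := e / 2.
have e20 : 0 < e2 by rewrite divr_gt0.
have Nvu : \forall y \near x, `|'D_v ('D_u f) x - 'D_v ('D_u f) y| < e2.
  have /cvgrPdist_lt :=
    smooth_continuous (smooth_derive v (smooth_derive u sf)) Ax.
  by apply.
have Nuv : \forall y \near x, `|'D_u ('D_v f) x - 'D_u ('D_v f) y| < e2.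
  have /cvgrPdist_lt :=
    smooth_continuous (smooth_derive u (smooth_derive v sf)) Ax.
  by apply.
have NA : \forall y \near x, A y by exact: open_nbhs_nbhs.
have [t t0 tA] := near_parallelogram u v (filterI NA (filterI Nvu Nuv)).
have [|r [s [r0 s0 E]]] := @second_difference f A x u v t t0 sf.
  by move=> r s r0 s0; have [] := tA _ _ r0 s0.
have [|r' [s' [r'0 s'0 E']]] := @second_difference f A x v u t t0 sf.
  by move=> r' s' r'0 s'0; rewrite addrAC; have [] := tA _ _ s'0 r'0.
have EE : 'D_v ('D_u f) (x + r *: u + s *: v)
        = 'D_u ('D_v f) (x + s' *: u + r' *: v).
  apply: (mulfI (lt0r_neq0 t0)); apply: (mulfI (lt0r_neq0 t0)).
  rewrite (addrAC x (s' *: u)); apply: etrans (esym E) _.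
  by apply: etrans _ E'; rewrite (addrAC x (t *: v)); ring.
have [_ [Bvu _]] := tA _ _ r0 s0; rewrite EE in Bvu.
have [_ [_ Buv]] := tA _ _ s'0 r'0.
exact: dist_le_halves Bvu Buv.
Qed.

Lemma Ck_entry k (A : set V) m n (f : V -> 'M[R]_(m, n)) i j : open A ->
  Ck k A f -> Ck k A (fun y => f y i j : R).
Proof.
move=> oA; elim: k f => [|k IHk] f /=.
  move=> cf x Ax.
  apply: (@continuous_comp _ _ _ f (fun M : 'M[R]_(m, n) => M i j)).
    exact: cf.
  exact: coord_continuous.
move=> [df Df]; split=> [x Ax|v].
  by move/differentiable_mxP: (df x Ax).
by apply: Ck_eq (IHk _ (Df v)) => // x Ax; rewrite derive_mxE//; exact: df.
Qed.

Lemma second_derivative_symmetric m (f : V -> 'rV[R]_m) (A : set V)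
    (x u v : V) :
  open A -> smooth_on A f -> A x -> 'D_v ('D_u f) x = 'D_u ('D_v f) x.
Proof.
move=> oA sf Ax.
have scoord j : smooth_on A (fun y => f y 0 j : R).
  by move=> k; exact: Ck_entry oA (sf k).
apply/rowP => j.
have Dj w : \forall y \near x, ('D_w f y) 0 j = 'D_w (fun y => f y 0 j : R) y.
  apply: near_open oA Ax _ => y Ay.
  by apply: derive_mxE; exact: smooth_differentiable sf Ay.
have DD w : differentiable ('D_w f) x.
  exact: smooth_differentiable (smooth_derive w sf) Ax.
apply: etrans (derive_mxE v 0 j (DD u)) _.
apply: etrans _ (esym (derive_mxE u 0 j (DD v))).
apply: etrans (near_eq_derive v (Dj u)) _.
apply: etrans _ (esym (near_eq_derive u (Dj v))).
exact: second_derivative_symmetric_scalar oA (scoord j) Ax.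
Qed.

End Schwarz.

(** * Bilinear forms, trilinear forms and types of three-forms *)

Section Bil.
Context {R : realType} {n : nat}.
Implicit Types (G H : 'M[R]_n) (u v w : 'rV[R]_n).

Lemma bilDl G u v w : bil G (u + v) w = bil G u w + bil G v w.
Proof. by rewrite /bil !mulmxDl mxE. Qed.

Lemma bilDr G u v w : bil G w (u + v) = bil G w u + bil G w v.
Proof. by rewrite /bil linearD mulmxDr mxE. Qed.

Lemma bilZl G a u v : bil G (a *: u) v = a * bil G u v.
Proof. by rewrite /bil -!scalemxAl mxE. Qed.

Lemma bilZr G a u v : bil G u (a *: v) = a * bil G u v.
Proof. by rewrite /bil linearZ /= -!scalemxAr mxE. Qed.

Lemma bil_addmx (G H : 'M[R]_n) v w : bil (G + H) v w = bil G v w + bil H v w.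
Proof. by rewrite /bil mulmxDr mulmxDl mxE. Qed.

Lemma bil_scalemx a (G : 'M[R]_n) v w : bil (a *: G) v w = a * bil G v w.
Proof. by rewrite /bil -scalemxAr -scalemxAl mxE. Qed.

Lemma bilNl G u v : bil G (- u) v = - bil G u v.
Proof. by rewrite -scaleN1r bilZl mulN1r. Qed.

Lemma bilNr G u v : bil G u (- v) = - bil G u v.
Proof. by rewrite -scaleN1r bilZr mulN1r. Qed.

Lemma bilBl G u v w : bil G (u - v) w = bil G u w - bil G v w.
Proof. by rewrite bilDl bilNl. Qed.

Lemma bil_mulmx G H v w : bil (H *m G) v w = bil G (v *m H) w.
Proof. by rewrite /bil mulmxA. Qed.

Lemma bil_mulmxr G H v w : bil (G *m H^T) v w = bil G v (w *m H).
Proof. by rewrite /bil trmx_mul !mulmxA. Qed.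

Lemma bil_delta G i j : bil G (delta_mx 0 i) (delta_mx 0 j) = G i j.
Proof. by rewrite /bil -rowE trmx_delta -colE !mxE. Qed.

Lemma bil_inj G H : (forall v w, bil G v w = bil H v w) -> G = H.
Proof. by move=> GH; apply/matrixP => i j; rewrite -!bil_delta. Qed.

Lemma bil_sym G : (forall v w, bil G v w = bil G w v) -> G^T = G.
Proof. by move=> Gs; apply/matrixP => i j; rewrite mxE -!bil_delta. Qed.

Lemma bil_tr G v w : bil G^T v w = bil G w v.
Proof.
rewrite /bil; have -> : v *m G^T *m w^T = (w *m G *m v^T)^T.
  by rewrite !trmx_mul trmxK mulmxA.
by rewrite mxE.
Qed.

End Bil.

Section Gram.
Context {R : realType}.

Definition posdef n (S : 'M[R]_n) : Prop :=
  S^T = S /\ forall v : 'rV[R]_n, v != 0 -> 0 < bil S v v.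

(** Cholesky factorization: complete the square in the first coordinate; the
   Schur complement is again positive definite. *)
Lemma gram_posdef n (S : 'M[R]_n) :
  posdef S -> exists L : 'M[R]_n, S = L^T *m L.
Proof.
elim: n S => [|n IHn] S.
  by move=> _; exists 0; apply/matrixP => -[].
rewrite -[n.+1]/(1 + n)%N in S *.
move=> [symS posS].
pose a := S 0 0; pose b : 'rV[R]_n := ursubmx S; pose c : 'M[R]_n := drsubmx S.
have Eul : ulsubmx S = a%:M.
  by rewrite [ulsubmx S]mx11_scalar !mxE; congr (S _ _)%:M; apply/val_inj.
have Ebl : dlsubmx S = b^T by rewrite /b -[in LHS]symS trmx_ursub.
have ES : S = block_mx a%:M b b^T c by rewrite -Eul -Ebl submxK.
have c_sym : c^T = c by rewrite /c trmx_drsub symS.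
have a0 : 0 < a.
  rewrite /a -bil_delta; apply: posS; apply/eqP => /matrixP/(_ 0 0)/eqP.
  by rewrite !mxE !eqxx oner_eq0.
pose S' := c - a^-1 *: (b^T *m b).
have S'pos : posdef S'.
  split; first by rewrite linearB /= linearZ /= trmx_mul trmxK c_sym.
  move=> w w0.
  (* the first coordinate that minimizes the form on the line above w *)
  pose t : 'M[R]_1 := - a^-1 *: (w *m b^T).
  have := posS (row_mx t w).
  rewrite /bil ES tr_row_mx mul_row_block mul_row_col.
  have -> : t *m a%:M + w *m b^T = 0.
    by rewrite mul_mx_scalar scalerA mulrN divff ?gt_eqF// scaleN1r addNr.
  rewrite mul0mx add0r /S' mulmxBr mulmxBl -scalemxAr -scalemxAl.
  rewrite mulmxDl addrC {1}/t -!scalemxAl scaleNr !mulmxA scaleNr; apply.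
  by apply: contraNneq w0; rewrite -row_mx0 => /eq_row_mx[_ ->].
have [L' EL'] := IHn _ S'pos.
pose s := Num.sqrt a.
have s0 : s != 0 by rewrite sqrtr_eq0 -ltNge.
have ss : s * s = a by rewrite -expr2 sqr_sqrtr// ltW.
exists (block_mx s%:M (s^-1 *: b) 0 L').
rewrite tr_block_mx mulmx_block !trmx0 !mul0mx !mulmx0 !addr0 tr_scalar_mx.
rewrite ES; congr block_mx.
- by rewrite -scalar_mxM ss.
- by rewrite mul_scalar_mx scalerA divff// scale1r.
- by rewrite linearZ /= mul_mx_scalar scalerA divff// scale1r.
- rewrite -EL' /S' [(s^-1 *: b)^T]linearZ /= -[in RHS]scalemxAl -scalemxAr.
  rewrite scalerA -invfM ss.
  by rewrite addrC subrK.
Qed.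

Lemma posdef_unit n (S : 'M[R]_n) : posdef S -> S \in unitmx.
Proof.
move=> [_ Spos]; rewrite -row_free_unit -kermx_eq0; apply/rowV0P => v.
move=> /sub_kermxP vS; apply/eqP; apply: contraT => /Spos.
by rewrite /bil vS mul0mx mxE ltxx.
Qed.

End Gram.

Section MultilinearContraction.
Context {R : realType} {n : nat}.

Lemma scalar_row_sum (phi : 'rV[R]_n -> R) u : scalar phi ->
  phi u = \sum_j u 0 j * phi (delta_mx 0 j).
Proof.
move=> phi_lin.
pose phi' : {scalar 'rV[R]_n} :=
  HB.pack phi (GRing.isLinear.Build _ _ _ _ phi phi_lin).
rewrite {1}(row_sum_delta u) -[phi]/(phi' : _ -> _) linear_sum.
by apply: eq_bigr => j _; rewrite linearZ.
Qed.

(** The contraction of phi (x) psi with two families of vectors only depends on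
   their mixed Gram matrix A^T B; this is what lets one family replace another
   below. *)
Lemma contraction_gram m (phi psi : 'rV[R]_n -> R) (A B : 'M[R]_(m, n)) :
  scalar phi -> scalar psi ->
  \sum_a phi (row a A) * psi (row a B)
  = \sum_j \sum_k phi (delta_mx 0 j) * psi (delta_mx 0 k) * (A^T *m B) j k.
Proof.
move=> phi_lin psi_lin.
under eq_bigr => a _.
  rewrite (scalar_row_sum _ phi_lin) (scalar_row_sum _ psi_lin) mulr_suml.
  under eq_bigr do rewrite mulr_sumr.
  over.
rewrite exchange_big; apply: eq_bigr => j _.
rewrite exchange_big; apply: eq_bigr => k _ /=.
rewrite mxE mulr_sumr; apply: eq_bigr => a _; rewrite !mxE.
by rewrite mulrACA mulrC.
Qed.

(** When phi = psi, the right-hand side is a sum of squares. *)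
Lemma contraction_eq m (phi psi : 'rV[R]_n -> R) (A B C : 'M[R]_(m, n)) :
  scalar phi -> scalar psi -> A^T *m B = C^T *m C ->
  \sum_a phi (row a A) * psi (row a B) = \sum_a phi (row a C) * psi (row a C).
Proof. by move=> phi_lin psi_lin AB; rewrite !contraction_gram// AB. Qed.

Definition trilinear (D : 'rV[R]_n -> 'rV[R]_n -> 'rV[R]_n -> R) : Prop :=
  [/\ forall y z, scalar (fun x => D x y z),
      forall x z, scalar (fun y => D x y z) &
      forall x y, scalar (fun z => D x y z)].

Lemma contraction_pair (F F' : 'rV[R]_n -> 'rV[R]_n -> R) (A B C : 'M[R]_n) :
  (forall y, scalar (F^~ y)) -> (forall x, scalar (F x)) ->
  (forall y, scalar (F'^~ y)) -> (forall x, scalar (F' x)) ->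
  A^T *m B = C^T *m C ->
  \sum_a \sum_b F (row a A) (row b A) * F' (row a B) (row b B)
  = \sum_a \sum_b F (row a C) (row b C) * F' (row a C) (row b C).
Proof.
move=> F1 F2 F'1 F'2 AB.
rewrite exchange_big /=.
under eq_bigr => b _ do
  rewrite (contraction_eq (phi := F^~ (row b A)) (psi := F'^~ (row b B))
    _ _ AB)//.
rewrite exchange_big /=; apply: eq_bigr => a _.
exact: contraction_eq.
Qed.

(** Positivity of 1 + P(x)P(x)1 + P(x)1(x)P + 1(x)P(x)P on trilinear forms,
   P being positive and self-adjoint for G.  Take a G-orthonormal basis l_a,
   so that the l_a^T l_a sum to G^-1, and vectors k_a such that the k_a^T k_a
   sum to the positive matrix G^-1 P.  Multiplying the identity by
   D(l_a, l_b, l_c) and summing, each term with two P's becomes a sum of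
   squares of values of D on the vectors l and k.  So all
   D(l_a, l_b, l_c) vanish. *)
Lemma trilinear_positive0 (G P : 'M[R]_n) D :
  posdef G -> posdef (P *m G) -> trilinear D ->
  (forall x y z, D x y z + D (x *m P) (y *m P) z + D (x *m P) y (z *m P)
                 + D x (y *m P) (z *m P) = 0) ->
  forall x y z, D x y z = 0.
Proof.
move=> Gpos Hpos [D1 D2 D3] Dsum.
have Gunit := posdef_unit Gpos.
pose Gi := invmx G.
have Gi_sym : Gi^T = Gi by rewrite trmx_inv Gpos.1.
have congrpos (S : 'M[R]_n) : posdef S -> posdef (Gi *m S *m Gi).
  move=> [Ssym Spos]; split; first by rewrite !trmx_mul Gi_sym Ssym mulmxA.
  move=> v v0; rewrite -[X in _ *m X]Gi_sym bil_mulmxr bil_mulmx; apply: Spos.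
  by apply: contraNneq v0 => vGi; rewrite -(mulmxKV Gunit v) vGi mul0mx.
have Gipos : posdef Gi by have := congrpos _ Gpos; rewrite mulVmx// mul1mx.
have GiPpos : posdef (Gi *m P).
  by have := congrpos _ Hpos; rewrite mulmxA mulmxK.
have [L EL] := gram_posdef Gipos.
have [K EK] := gram_posdef GiPpos.
(* P is contracted between two copies of the basis l *)
have LPK : L^T *m (L *m P) = K^T *m K by rewrite mulmxA -EL.
pose l a := row a L.
have lP a : l a *m P = row a (L *m P) by rewrite -row_mul.
have sum12 : 0 <= \sum_a \sum_b \sum_c
    D (l a) (l b) (l c) * D (l a *m P) (l b *m P) (l c).
  under eq_bigr do rewrite exchange_big /=.
  rewrite exchange_big /=; apply: sumr_ge0 => c _.
  under eq_bigr do under eq_bigr do rewrite !lP.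
  rewrite (contraction_pair (F := fun x y => D x y (l c))
    (F' := fun x y => D x y (l c)) _ _ _ _ LPK)//.
  by apply: sumr_ge0 => a _; apply: sumr_ge0 => b _; rewrite -expr2 sqr_ge0.
have sum13 : 0 <= \sum_a \sum_b \sum_c
    D (l a) (l b) (l c) * D (l a *m P) (l b) (l c *m P).
  rewrite exchange_big /=; apply: sumr_ge0 => b _.
  under eq_bigr do under eq_bigr do rewrite !lP.
  rewrite (contraction_pair (F := fun x z => D x (l b) z)
    (F' := fun x z => D x (l b) z) _ _ _ _ LPK)//.
  by apply: sumr_ge0 => a _; apply: sumr_ge0 => c _; rewrite -expr2 sqr_ge0.
have sum23 : 0 <= \sum_a \sum_b \sum_c
    D (l a) (l b) (l c) * D (l a) (l b *m P) (l c *m P).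
  apply: sumr_ge0 => a _.
  under eq_bigr do under eq_bigr do rewrite !lP.
  rewrite (contraction_pair (F := D (l a)) (F' := D (l a)) _ _ _ _ LPK)//.
  by apply: sumr_ge0 => b _; apply: sumr_ge0 => c _; rewrite -expr2 sqr_ge0.
have sq_ge0 a : 0 <= \sum_b \sum_c D (l a) (l b) (l c) ^+ 2.
  by apply: sumr_ge0 => b _; apply: sumr_ge0 => c _; rewrite sqr_ge0.
have sum0 : \sum_a \sum_b \sum_c D (l a) (l b) (l c) ^+ 2 = 0.
  apply/eqP; rewrite eq_le sumr_ge0// andbT.
  apply: (@le_trans _ _ (\sum_a \sum_b \sum_c
    (D (l a) (l b) (l c) ^+ 2
    + D (l a) (l b) (l c) * D (l a *m P) (l b *m P) (l c)
    + D (l a) (l b) (l c) * D (l a *m P) (l b) (l c *m P)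
    + D (l a) (l b) (l c) * D (l a) (l b *m P) (l c *m P)))).
    under [leRHS]eq_bigr do under eq_bigr do rewrite !big_split /=.
    under [leRHS]eq_bigr do rewrite !big_split /=.
    by rewrite !big_split /= -!addrA lerDl !addr_ge0.
  rewrite big1// => a _; rewrite big1// => b _; rewrite big1// => c _.
  by rewrite expr2 -!mulrDr Dsum mulr0.
have Dl a b c : D (l a) (l b) (l c) = 0.
  move/eqP: sum0; rewrite psumr_eq0// => /allP/(_ a (mem_index_enum _)) /=.
  rewrite psumr_eq0 => [|b' _]; last first.
    by apply: sumr_ge0 => c' _; rewrite sqr_ge0.
  move=> /allP/(_ b (mem_index_enum _)) /=.
  rewrite psumr_eq0 => [|c' _]; last by rewrite sqr_ge0.
  by move=> /allP/(_ c (mem_index_enum _)) /=; rewrite sqrf_eq0 => /eqP.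
have Lunit : L \in unitmx.
  have := posdef_unit Gipos; rewrite EL unitmx_mul => /andP[_ ->] //.
have ext (phi : 'rV[R]_n -> R) : scalar phi -> (forall a, phi (l a) = 0) ->
    forall x, phi x = 0.
  move=> phi_lin phi0 x.
  pose phi' : {scalar 'rV[R]_n} :=
    HB.pack phi (GRing.isLinear.Build _ _ _ _ phi phi_lin).
  rewrite -(mulmxKV Lunit x) mulmx_sum_row -[phi]/(phi' : _ -> _) linear_sum.
  by rewrite big1// => a _; rewrite linearZ /= phi0 mulr0.
move=> x y z.
apply: (ext (fun x => D x y z)) => // a.
apply: (ext (fun y => D _ y z)) => // b.
exact: (ext (fun z => D _ _ z)).
Qed.

End MultilinearContraction.

Section Type30.
Context {R : realType} {n : nat}.

(** The hypotheses on D are those of type (3,0) + (0,3) for J and of type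
   (2,1) + (1,2) for I.  With P = - J I, that is v |-> - v I J on row vectors,
   I is P followed by J, so D(Ix, Iy, z) = - D(Px, Py, z) and
   [trilinear_positive0] applies. *)
Lemma type30_type21_eq0 (G J I : 'M[R]_n) D :
  posdef G ->
  J *m J = - 1%:M -> (forall v w, bil G (v *m J) (w *m J) = bil G v w) ->
  I *m I = - 1%:M ->
  (forall v w, bil G (v *m I *m J) (w *m I) = bil G (v *m J) w) ->
  (forall v, v != 0 -> 0 < bil G (v *m J) (v *m I)) ->
  trilinear D ->
  (forall x y z, D (x *m J) (y *m J) z = - D x y z) ->
  (forall x y z, D (x *m J) y (z *m J) = - D x y z) ->
  (forall x y z, D x (y *m J) (z *m J) = - D x y z) ->
  (forall x y z, D x y z
     = D (x *m I) (y *m I) z + D (x *m I) y (z *m I) + D x (y *m I) (z *m I)) ->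
  forall x y z, D x y z = 0.
Proof.
move=> Gpos JJ GJ II Iomega Itame Dlin J12 J13 J23 DI.
pose P := - (I *m J).
have IPJ (v : 'rV_n) : v *m I = v *m P *m J.
  by rewrite /P mulmxN mulNmx -!mulmxA JJ !mulmxN mulmx1 opprK.
have Gsym v w : bil G v w = bil G w v by rewrite -{1}Gpos.1 bil_tr.
have vII (v : 'rV_n) : v *m I *m I = - v by rewrite -mulmxA II mulmxN mulmx1.
have GP v w : bil G (v *m P) w = bil G (v *m I) (w *m J) by rewrite IPJ GJ.
apply: (@trilinear_positive0 _ _ G P) => //.
  split; last first.
    by move=> v v0; rewrite bil_mulmx GP Gsym; exact: Itame.
  apply: bil_sym => v w; rewrite !bil_mulmx GP Gsym -Iomega vII bilNr.
  by rewrite -bilNl /P mulmxN mulmxA.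
move=> x y z; rewrite {1}(DI x y z) !(IPJ x) !(IPJ y) !(IPJ z) J12 J13 J23.
by ring.
Qed.

End Type30.

(** * Tensor fields in charts *)

Section ChartCalculus.
Context {R : realType} {n : nat} {M : manifold R n}.
Implicit Types (c d e : chart R n M) (p q : M) (U : set M).

Lemma chart_image_open c U : open U -> open (chart_image c U).
Proof.
move=> oU; rewrite openE => x [cx Ux]; rewrite /interior.
have Ncim : nbhs x (cim c).
  by apply: open_nbhs_nbhs; split=> //; exact: cim_open.
have NU : nbhs x (cinv c @^-1` U).
  apply: (cinv_continuous cx); exact: open_nbhs_nbhs.
by apply: filterS (filterI Ncim NU) => y [].
Qed.

Lemma cmap_chart_image c U q : cdom c q -> U q -> chart_image c U (cmap c q).
Proof. by move=> cq Uq; split; [exact: cmap_im|rewrite cmapK]. Qed.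

Lemma smooth_transition c d : atlas c -> atlas d ->
  smooth_on (chart_image c (cdom d)) (transition c d).
Proof. by move=> ac ad; case: (atlas_compatible ac ad). Qed.

Lemma transition_differentiable c d q : atlas c -> atlas d ->
  cdom c q -> cdom d q -> differentiable (transition c d) (cmap c q).
Proof.
move=> ac ad cq dq; apply: (smooth_differentiable (smooth_transition ac ad)).
exact: cmap_chart_image.
Qed.

(** The cocycle property, by the chain rule. *)
Lemma jacobian_transition c d e q : atlas c -> atlas d -> atlas e ->
  cdom c q -> cdom d q -> cdom e q ->
  jacobian (transition c e) (cmap c q)
  = jacobian (transition c d) (cmap c q)
    *m jacobian (transition d e) (cmap d q).
Proof.
move=> ac ad ae cq dq eq.
have Ecd : transition c d (cmap c q) = cmap d q by rewrite /transition /= cmapK.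
have dcd := transition_differentiable ac ad cq dq.
have dce := transition_differentiable ac ae cq eq.
have dde := transition_differentiable ad ae dq eq.
apply/row_matrixP => i; rewrite !rowE mulmxA.
apply: etrans (row_mul_jacobian _ dce) _.
apply: etrans _ (esym (row_mul_jacobian _ dde)).
have -> := row_mul_jacobian (delta_mx 0 i) dcd.
have dde' : differentiable (transition d e) (transition c d (cmap c q)).
  by rewrite Ecd.
rewrite -Ecd; apply: etrans _ (derive_comp _ dcd dde').
apply: near_eq_derive.
apply: (@near_open _ _ (chart_image c (cdom d))).
- by apply: chart_image_open; exact: cdom_open.
- exact: cmap_chart_image.
by move=> y [cy dy]; rewrite /transition /= cmapK.
Qed.

Lemma jacobian_transition_id c q : cdom c q ->
  jacobian (transition c c) (cmap c q) = 1%:M.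
Proof.
move=> cq.
have near_id : \forall y \near cmap c q, y = transition c c y.
  apply: (@near_open _ _ (cim c)); [exact: cim_open|exact: cmap_im|].
  by move=> y cy; rewrite /transition /= cinvK.
apply/row_matrixP => i; rewrite !rowE row_mul_jacobian.
  rewrite -(@near_eq_derive _ _ _ id (transition c c) _ _ near_id) mulmx1.
  exact: derive_id.
exact: (@near_eq_differentiable _ _ _ id (transition c c) _ near_id).
Qed.

Lemma jacobian_transition_unit c d q : atlas c -> atlas d ->
  cdom c q -> cdom d q ->
  jacobian (transition c d) (cmap c q) \in unitmx.
Proof.
move=> ac ad cq dq; have E := jacobian_transition ac ad ac cq dq cq.
have [u _] := mulmx1_unit (etrans (esym E) (jacobian_transition_id cq)).
exact: u.
Qed.

Lemma chg_unit c q : atlas c -> cdom c q -> chg c q \in unitmx.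
Proof.
move=> ac cq; apply: jacobian_transition_unit => //.
  exact: chart_at_atlas.
exact: chart_at_dom.
Qed.

Lemma chg_transition c d q : atlas c -> atlas d -> cdom c q -> cdom d q ->
  chg d q = chg c q *m jacobian (transition c d) (cmap c q).
Proof.
by move=> ac ad cq dq; apply: jacobian_transition => //;
  [exact: chart_at_atlas|exact: chart_at_dom].
Qed.

Lemma chg_chart_at p : chg (chart_at p) p = 1%:M.
Proof. by apply: jacobian_transition_id; exact: chart_at_dom. Qed.

Lemma vec_in_endo_app c (A : mxfield M) (X : vfield M) x :
  atlas c -> cim c x ->
  vec_in c (endo_app A X) x = vec_in c X x *m endo_in c A x.
Proof.
move=> ac cx; rewrite /vec_in /endo_in /endo_app !mulmxA.
by rewrite mulmxK// chg_unit//; exact: cinv_dom.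
Qed.

Lemma bil_form_in c (G : mxfield M) (X Y : vfield M) x :
  atlas c -> cim c x ->
  bil (G (cinv c x)) (X (cinv c x)) (Y (cinv c x))
  = bil (form_in c G x) (vec_in c X x) (vec_in c Y x).
Proof.
move=> ac cx; rewrite /bil /form_in /vec_in.
have u : chg c (cinv c x) \in unitmx by rewrite chg_unit//; exact: cinv_dom.
rewrite trmx_mul !mulmxA mulmxK//.
by rewrite -[in RHS](mulmxA _ _ (chg _ _)^T) -trmx_mul mulmxV// trmx1 mulmx1.
Qed.

(** Constant coordinates in the chart c. *)
Definition chart_field c (u : 'rV[R]_n) : vfield M :=
  fun q => u *m invmx (chg c q).

Lemma vec_in_chart_field c u x : atlas c -> cim c x ->
  vec_in c (chart_field c u) x = u.
Proof.
move=> ac cx; rewrite /vec_in /chart_field mulmxKV// chg_unit//.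
exact: cinv_dom.
Qed.

Lemma chart_field_at p u : chart_field (chart_at p) u p = u.
Proof. by rewrite /chart_field chg_chart_at invmx1 mulmx1. Qed.

(** In another chart d the components are D_u of the transition map from c to d,
   taken at the point transported back to c. *)
Lemma smooth_chart_field c u : atlas c -> smooth_vec (cdom c) (chart_field c u).
Proof.
move=> ac d ad.
have oD : open (chart_image d (cdom c)) by apply/chart_image_open/cdom_open.
apply: (@smooth_on_eq _ _ _ _ ('D_u (transition c d) \o transition d c)) => //.
  move=> x [dx cx]; rewrite /vec_in /chart_field.
  have dcx := cinv_dom dx.
  rewrite (chg_transition ac ad)// !mulmxA mulmxKV ?chg_unit//.
  by rewrite (row_mul_jacobian _ (transition_differentiable ac ad cx dcx)).
apply: (@smooth_comp _ _ _ _ _ (chart_image c (cdom d))) => //.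
- move=> x [dx cx]; apply: cmap_chart_image => //; exact: cinv_dom.
- exact: smooth_transition.
- exact/smooth_derive/smooth_transition.
Qed.

Lemma smooth_vec_endo_app U (A : mxfield M) (X : vfield M) :
  open U -> smooth_endo A -> smooth_vec U X -> smooth_vec U (endo_app A X).
Proof.
move=> oU sA sX c ac; have oD := @chart_image_open c _ oU.
apply: (@smooth_on_eq _ _ _ _ (fun x => vec_in c X x *m endo_in c A x)) => //.
  by move=> x [cx _]; rewrite vec_in_endo_app.
apply: smooth_mulmx => //; first exact: sX.
by apply: smooth_on_sub (sA c ac) => x [].
Qed.

Lemma smooth_vec_add U (X Y : vfield M) : open U ->
  smooth_vec U X -> smooth_vec U Y -> smooth_vec U (fun q => X q + Y q).
Proof.
move=> oU sX sY c ac; have oD := @chart_image_open c _ oU.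
apply: (@smooth_on_eq _ _ _ _ (fun x => vec_in c X x + vec_in c Y x)) => //.
  by move=> x _; rewrite /vec_in mulmxDl.
by apply: smooth_add; [|exact: sX|exact: sY].
Qed.

Lemma smooth_vec0 U : smooth_vec U (fun=> 0 : 'rV[R]_n).
Proof.
move=> c ac; rewrite /vec_in; under eq_fun do rewrite mul0mx.
exact: smooth_cst.
Qed.

Lemma smooth_fun_cst U (a : R) : smooth_fun U (fun=> a).
Proof. by move=> c ac; exact: smooth_cst. Qed.

Lemma vec_in_chart_at (X : vfield M) p :
  vec_in (chart_at p) X (cmap (chart_at p) p) = X p.
Proof.
by rewrite /vec_in cmapK ?chg_chart_at ?mulmx1//; exact: chart_at_dom.
Qed.

Lemma endo_in_chart_at (A : mxfield M) p :
  endo_in (chart_at p) A (cmap (chart_at p) p) = A p.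
Proof.
rewrite /endo_in cmapK ?chg_chart_at ?invmx1 ?mulmx1 ?mul1mx//.
exact: chart_at_dom.
Qed.

Lemma form_in_chart_at (A : mxfield M) p :
  form_in (chart_at p) A (cmap (chart_at p) p) = A p.
Proof.
rewrite /form_in cmapK ?chg_chart_at ?invmx1 ?trmx1 ?mulmx1 ?mul1mx//.
exact: chart_at_dom.
Qed.

End ChartCalculus.

(** * The exterior derivative and the Nijenhuis tensor in coordinates *)

Section LocalForms.
Context {R : realType} {n : nat}.
Implicit Types (A W Q : 'rV[R]_n -> 'M[R]_n) (x u v w : 'rV[R]_n).

(** d omega for the two-form with coefficient matrix W; the terms with Lie
   brackets are absent for constant vectors u, v, w. *)
Definition ext_d W x u v w : R :=
  bil ('D_u W x) v w + bil ('D_v W x) w u + bil ('D_w W x) u v.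

Lemma cyclic_sum_trilinear (T : 'rV[R]_n -> 'M[R]_n) : linear T ->
  trilinear (fun u v w => bil (T u) v w + bil (T v) w u + bil (T w) u v).
Proof.
move=> T_lin.
have TE a u v : T (a *: u + v) = a *: T u + T v by exact: T_lin.
split=> u v a b c /=;
  rewrite TE bil_addmx bil_scalemx !(bilDr, bilDl) !(bilZl, bilZr); ring.
Qed.

Lemma ext_d_trilinear W x : differentiable W x -> trilinear (ext_d W x).
Proof. by move=> dW; exact: cyclic_sum_trilinear (derive_dir_linear dW). Qed.

(** The Nijenhuis tensor of the endomorphism field A on the constant fields u
   and v. *)
Definition nijenhuis_coord A x u v : 'rV[R]_n :=
  v *m 'D_(u *m A x) A x - u *m 'D_(v *m A x) A x
  + u *m 'D_v A x *m A x - v *m 'D_u A x *m A x.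

(** Differentiating the invariance W = A W A^T expresses the failure of dW to be
   of type (2,1) + (1,2) through the derivatives of A alone, and what appears is
   the cyclic sum of W(N(u, v), w), where N is the Nijenhuis tensor. *)
Lemma ext_d_type21 A W x :
  differentiable A x -> differentiable W x ->
  (\forall y \near x, A y *m A y = - 1%:M) ->
  (forall v w, bil (W x) v w = - bil (W x) w v) ->
  (\forall y \near x, W y = A y *m W y *m (A y)^T) ->
  (forall u v, nijenhuis_coord A x u v = 0) ->
  forall u v w, ext_d W x u v w
    = ext_d W x (u *m A x) (v *m A x) w + ext_d W x (u *m A x) v (w *m A x)
      + ext_d W x u (v *m A x) (w *m A x).
Proof.
move=> dA dW AAnear skew AWA N u v w; have AA := nbhs_singleton AAnear.
set a := A x; pose Ad u := 'D_u A x; pose Wd u := 'D_u W x.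
pose om := bil (W x).
have vaa (b : 'rV_n) : b *m a *m a = - b by rewrite -mulmxA AA mulmxN mulmx1.
have Wx : W x = a *m W x *m a^T := nbhs_singleton AWA.
have om_a b c : om (b *m a) (c *m a) = om b c.
  by rewrite /om [in RHS]Wx bil_mulmxr bil_mulmx.
have Wd_eq s b c : bil (Wd s) b c
    = bil (Wd s) (b *m a) (c *m a) + om (b *m Ad s) (c *m a)
      + om (b *m a) (c *m Ad s).
  have dAW := differentiable_mulmx dA dW.
  have dAT := differentiable_trmx dA.
  have E : Wd s = (Ad s *m W x + a *m Wd s) *m a^T + a *m W x *m (Ad s)^T.
    apply: etrans (near_eq_derive s AWA) _.
    apply: etrans (derive_mulmx s dAW dAT) _.
    have -> := derive_mulmx s dA dW.
    by have -> := derive_trmx s dA.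
  rewrite {1}E bil_addmx 2!bil_mulmxr bil_addmx !bil_mulmx -/om.
  by rewrite [X in X + _]addrC.
have om_aC b c : om b (c *m a) = - om (b *m a) c.
  by rewrite -(om_a b (c *m a)) vaa /om bilNr.
have Ada s b : b *m a *m Ad s = - (b *m Ad s *m a).
  have E : Ad s *m a + a *m Ad s = 0.
    apply: etrans (esym (derive_mulmx s dA dA)) _.
    apply: etrans (near_eq_derive s AAnear) _.
    exact: derive_cst.
  by rewrite -!mulmxA -(addr0_eq E) mulmxN.
have om_skew b c : om b c = - om c b := skew b c.
have omNr b c : om b (- c) = - om b c by rewrite /om bilNr.
pose B s b c := bil (Wd s) b c.
(* key gathers the derivatives of W along the images under A, key2 the others;
   keyN makes the two right-hand sides agree after the cyclic sum *)
have key s b c : B (s *m a) (b *m a) c + B (s *m a) b (c *m a)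
   = om (c *m Ad (s *m a)) b - om (b *m Ad (s *m a)) c.
  rewrite /B (Wd_eq _ b) vaa Ada bilNr !omNr om_a (om_skew (c *m _)).
  ring.
have key2 s b c : B s b c - B s (b *m a) (c *m a)
   = om (c *m Ad s *m a) b - om (b *m Ad s *m a) c.
  rewrite /B (Wd_eq s b) om_aC (om_skew _ b) (om_aC b) opprK.
  ring.
have keyN s b c : om (b *m Ad (s *m a)) c - om (s *m Ad (b *m a)) c
  + om (s *m Ad b *m a) c - om (b *m Ad s *m a) c = 0.
  by rewrite /om -!bilNl -!bilDl -/(nijenhuis_coord A x s b) N /bil !mul0mx mxE.
have extE p q r : ext_d W x p q r = B p q r + B q r p + B r p q by [].
rewrite !extE.
have := (key u v w, key v w u, key w u v).
have := (key2 u v w, key2 v w u, key2 w u v).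
have := (keyN u v w, keyN v w u, keyN w u v).
(* the remaining statement is linear in the values of B and om *)
move: B om Ad a
  {Wx om_a vaa om_aC Wd_eq Ada key key2 keyN om_skew omNr extE} => B om Ad a.
move=> [[n1 n2] n3] [[l1 l2] l3] [[k1 k2] k3].
lra.
Qed.

(** The pointwise identity behind [nijenhuis_coord_conj]: Ad and Qd stand for
   the derivatives of A and Q, and [a q = q S] has been differentiated once. *)
Lemma nijenhuis_conj_algebra (a q S : 'M[R]_n) (Ad Qd : 'rV[R]_n -> 'M[R]_n)
    u v :
  q \in unitmx -> (forall s b : 'rV_n, b *m Qd s = s *m Qd b) ->
  a *m q = q *m S ->
  (forall s b : 'rV_n, b *m Ad s *m q = b *m Qd s *m S - b *m a *m Qd s) ->
  v *m Ad (u *m a) - u *m Ad (v *m a) + u *m Ad v *m a - v *m Ad u *m a = 0.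
Proof.
move=> qu Qs aq AdQ; apply: (can_inj (mulmxK qu)).
have aqr (b : 'rV_n) : b *m a *m q = b *m q *m S by rewrite -!mulmxA aq.
rewrite !(mulmxBl, mulmxDl) !aqr !AdQ mul0mx.
rewrite (Qs (u *m a) v) (Qs (v *m a) u) (Qs (u *m a) (v *m a)) (Qs v u).
rewrite !mulmxBl.
move: (u *m a *m Qd v *m S) (u *m a *m Qd (v *m a)) (v *m a *m Qd u *m S).
move: (v *m Qd u *m S *m S) => p4 p1 p2 p3.
by apply/rowP => j; rewrite !mxE; ring.
Qed.

(** A structure conjugate to a constant one by a field Q of matrices of the
   form D phi is integrable: the symmetry hypothesis on the derivatives of Q is
   that of the second derivatives of phi, and every term of N is multiplied by
   Q on the right and expanded with A Q = Q S. *)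
Lemma nijenhuis_coord_conj A Q (S : 'M[R]_n) x :
  differentiable A x -> differentiable Q x -> Q x \in unitmx ->
  (forall u v, u *m 'D_v Q x = v *m 'D_u Q x) ->
  (\forall y \near x, A y *m Q y = Q y *m S) ->
  forall u v, nijenhuis_coord A x u v = 0.
Proof.
move=> dA dQ Qu Qsym AQ u v.
rewrite /nijenhuis_coord; set a := A x.
pose Ad u := 'D_u A x; pose Qd u := 'D_u Q x.
have aQ : a *m Q x = Q x *m S := nbhs_singleton AQ.
have AdQ s (b : 'rV_n) : b *m Ad s *m Q x = b *m Qd s *m S - b *m a *m Qd s.
  have E : Ad s *m Q x + a *m Qd s = Qd s *m S.
    apply: etrans (esym (derive_mulmx s dA dQ)) _.
    apply: etrans (near_eq_derive s AQ) _.
    apply: etrans (derive_mulmx s dQ (differentiable_cst S x)) _.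
    by rewrite derive_cst mulmx0 addr0.
  by rewrite -!mulmxA -E mulmxDr addrK.
apply: (nijenhuis_conj_algebra (Ad := Ad) (Qd := Qd) u v Qu _ aQ AdQ) => s b.
exact: Qsym.
Qed.

End LocalForms.

(** * Integrable structures at a point *)

Section PointwiseNijenhuis.
Context {R : realType} {n : nat} {M : manifold R n}.
Implicit Types (I J g A B : mxfield M) (p q : M) (c d : chart R n M).

Lemma cim_chart_at p : cim (chart_at p) (cmap (chart_at p) p).
Proof. by apply: cmap_im; exact: chart_at_dom. Qed.

Lemma near_chart_at p (P : 'rV[R]_n -> Prop) :
  (forall y, cim (chart_at p) y -> P y) ->
  \forall y \near cmap (chart_at p) p, P y.
Proof. by apply: near_open; [exact: cim_open|exact: cim_chart_at]. Qed.

Lemma endo_in_sqr c A x : atlas c -> cim c x ->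
  (forall p, A p *m A p = - 1%:M) -> endo_in c A x *m endo_in c A x = - 1%:M.
Proof.
move=> ac cx AA; have u := chg_unit ac (cinv_dom cx).
rewrite /endo_in !mulmxA mulmxK// -(mulmxA (invmx _)) AA mulmxN mulmx1 mulNmx.
by rewrite mulVmx.
Qed.

Lemma endo_in_differentiable p A : smooth_endo A ->
  differentiable (endo_in (chart_at p) A) (cmap (chart_at p) p).
Proof.
move=> sA; apply: smooth_differentiable (sA _ (chart_at_atlas p)) _.
exact: cim_chart_at.
Qed.

Lemma form_in_differentiable p A : smooth_form A ->
  differentiable (form_in (chart_at p) A) (cmap (chart_at p) p).
Proof.
move=> sA; apply: smooth_differentiable (sA _ (chart_at_atlas p)) _.
exact: cim_chart_at.
Qed.

Lemma vec_in_differentiable p U (X : vfield M) : U p -> smooth_vec U X ->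
  differentiable (vec_in (chart_at p) X) (cmap (chart_at p) p).
Proof.
move=> Up sX; apply: smooth_differentiable (sX _ (chart_at_atlas p)) _.
by apply: cmap_chart_image => //; exact: chart_at_dom.
Qed.

Lemma derive_vec_in_chart_field p u s :
  'D_s (vec_in (chart_at p) (chart_field (chart_at p) u))
    (cmap (chart_at p) p) = 0.
Proof.
rewrite (@near_eq_derive _ _ _ _ (cst u)); first exact: derive_cst.
apply: near_chart_at => y cy; rewrite vec_in_chart_field//.
exact: chart_at_atlas.
Qed.

Lemma derive_vec_in_endo_chart_field p A u s : smooth_endo A ->
  'D_s (vec_in (chart_at p) (endo_app A (chart_field (chart_at p) u)))
    (cmap (chart_at p) p)
  = u *m 'D_s (endo_in (chart_at p) A) (cmap (chart_at p) p).
Proof.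
move=> sA.
rewrite (@near_eq_derive _ _ _ _ (fun y => u *m endo_in (chart_at p) A y)).
  have dA := endo_in_differentiable p sA.
  apply: etrans (derive_mulmx s (differentiable_cst u _) dA) _.
  by rewrite derive_cst mul0mx add0r.
apply: near_chart_at => y cy.
have ap := chart_at_atlas p.
by rewrite vec_in_endo_app// vec_in_chart_field.
Qed.

(** The factor [chg] at p is the identity, so no Jacobian appears. *)
Lemma nijenhuis_chart_field I p u v : smooth_endo I ->
  nijenhuis I (chart_field (chart_at p) u) (chart_field (chart_at p) v) p
  = nijenhuis_coord (endo_in (chart_at p) I) (cmap (chart_at p) p) u v.
Proof.
move=> sI.
rewrite /nijenhuis /lie_bracket /endo_app -!/(endo_app I _).
rewrite !derive_vec_in_chart_field !derive_vec_in_endo_chart_field//.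
rewrite !chart_field_at /nijenhuis_coord endo_in_chart_at.
have simp (a b c e : 'rV[R]_n) (f : 'M[R]_n) :
    a - b - (0 - c) *m f - (e - 0) *m f - (0 - 0)
    = a - b + c *m f - e *m f.
  by rewrite !(sub0r, subr0, oppr0) mulNmx opprK.
exact: simp.
Qed.

Lemma nijenhuis_vanishes_coord I p u v :
  smooth_endo I -> nijenhuis_vanishes I ->
  nijenhuis_coord (endo_in (chart_at p) I) (cmap (chart_at p) p) u v = 0.
Proof.
move=> sI NI; rewrite -nijenhuis_chart_field//.
have ap := chart_at_atlas p.
apply: (NI (cdom (chart_at p))).
- exact: cdom_open.
- exact: smooth_chart_field.
- exact: smooth_chart_field.
- exact: chart_at_dom.
Qed.

Lemma endo_in_change c d A x : atlas c -> atlas d ->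
  chart_image d (cdom c) x ->
  endo_in d A x *m jacobian (transition d c) x
  = jacobian (transition d c) x *m endo_in c A (transition d c x).
Proof.
move=> ac ad [dx cx].
have cdx := cinv_dom dx.
have Exc : cinv c (transition d c x) = cinv d x by rewrite /transition /= cmapK.
rewrite /endo_in Exc.
have E := chg_transition ad ac cdx cx; rewrite (cinvK dx) in E.
have ud := chg_unit ad cdx.
have uc := chg_unit ac cx.
move: (chg c _) (chg d _) (jacobian _ _) uc ud E => b a j ub ua E.
have Ej : j *m invmx b = invmx a.
  apply: (can_inj (mulmxK ub)).
  by rewrite (mulmxKV ub) E mulmxA mulVmx// mul1mx.
by rewrite !mulmxA Ej -[in LHS](mulmxA _ a j) -E.
Qed.

(** In the chart at p the structure is the standard one conjugated by the
   Jacobian of the transition to a complex chart, whose derivatives are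
   symmetric by [second_derivative_symmetric]. *)
Lemma complex_nijenhuis_coord I p u v : smooth_endo I ->
  induced_by_complex_manifold I ->
  nijenhuis_coord (endo_in (chart_at p) I) (cmap (chart_at p) p) u v = 0.
Proof.
move=> sI [At [At_atlas At_cover _] At_I].
have [c Ac cp] := At_cover p.
have ac := At_atlas _ Ac; have ad := chart_at_atlas p.
have dp := chart_at_dom p.
set d := chart_at p in ad dp *.
have oD : open (chart_image d (cdom c)) by apply/chart_image_open/cdom_open.
have Dx : chart_image d (cdom c) (cmap d p) by exact: cmap_chart_image.
have st := smooth_transition ad ac.
apply: (@nijenhuis_coord_conj _ _ _ (jacobian (transition d c)) std_cplx).
- exact: endo_in_differentiable.
- exact: smooth_differentiable (smooth_jacobian oD st) Dx.
- exact: jacobian_transition_unit.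
- move=> a b; apply: etrans (derive_jacobian a b oD st Dx) _.
  apply: etrans _ (esym (derive_jacobian b a oD st Dx)).
  exact: second_derivative_symmetric oD st Dx.
- apply: near_open oD Dx _ => y Dy; rewrite endo_in_change//.
  congr (_ *m _); apply: At_I => //.
  by case: Dy => [dy cy]; exact: cmap_im.
Qed.

Lemma integrable_nijenhuis_coord I p u v : smooth_endo I -> integrable_acs I ->
  nijenhuis_coord (endo_in (chart_at p) I) (cmap (chart_at p) p) u v = 0.
Proof.
by move=> sI [cI|NI];
  [exact: complex_nijenhuis_coord|exact: nijenhuis_vanishes_coord].
Qed.

End PointwiseNijenhuis.

(** * Nearly Kähler manifolds *)

Section FundamentalForm.
Context {R : realType} {n : nat} {M : manifold R n} {g J : mxfield M}.
Hypothesis gJ : almost_hermitian g J.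
Implicit Types (X Y Z : vfield M) (p q : M) (U : set M) (c : chart R n M).

Let smooth_g : smooth_form g. Proof. by case: gJ => -[]. Qed.
Let smooth_J : smooth_endo J. Proof. by case: gJ => _ []. Qed.
Let g_sym p v w : bil (g p) v w = bil (g p) w v.
Proof. by case: gJ => -[]. Qed.
Let JJ p : J p *m J p = - 1%:M. Proof. by case: gJ => _ []. Qed.
Let g_J p v w : bil (g p) (v *m J p) (w *m J p) = bil (g p) v w.
Proof. by case: gJ. Qed.

Lemma kahler_form_skew p v w : kahler_form g J p v w = - kahler_form g J p w v.
Proof.
rewrite /kahler_form -(g_J p (v *m J p)) -mulmxA JJ mulmxN mulmx1 bilNl.
by rewrite g_sym.
Qed.

Lemma metric_posdef p : posdef (g p).
Proof. by case: gJ => -[_ sg pg] _ _; split; [exact/bil_sym/sg|exact: pg]. Qed.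

(** omega(v, w) = g(Jv, w), hence the coefficient matrix J g. *)
Definition omega_in c x : 'M[R]_n := endo_in c J x *m form_in c g x.

Lemma omega_inE c Y Z x : atlas c -> cim c x ->
  bil (omega_in c x) (vec_in c Y x) (vec_in c Z x)
  = kahler_form g J (cinv c x) (Y (cinv c x)) (Z (cinv c x)).
Proof.
move=> ac cx; rewrite /omega_in bil_mulmx -vec_in_endo_app// -bil_form_in//.
Qed.

Lemma omega_in_bil c v w x : atlas c -> cim c x ->
  bil (omega_in c x) v w = kahler_form g J (cinv c x)
    (chart_field c v (cinv c x)) (chart_field c w (cinv c x)).
Proof. by move=> ac cx; rewrite -omega_inE// !vec_in_chart_field. Qed.

Lemma omega_in_chart_at p v w :
  bil (omega_in (chart_at p) (cmap (chart_at p) p)) v w = kahler_form g J p v w.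
Proof. by rewrite /omega_in endo_in_chart_at form_in_chart_at bil_mulmx. Qed.

Lemma omega_in_differentiable p :
  differentiable (omega_in (chart_at p)) (cmap (chart_at p) p).
Proof.
by apply: differentiable_mulmx; [exact: endo_in_differentiable
  |exact: form_in_differentiable].
Qed.

Lemma omega_in_skew c x :
  atlas c -> cim c x -> (omega_in c x)^T = - omega_in c x.
Proof.
move=> ac cx; apply: bil_inj => v w.
rewrite bil_tr -scaleN1r bil_scalemx mulN1r.
by rewrite !omega_in_bil// kahler_form_skew.
Qed.

Lemma derive_omega_skew p s v w :
  bil ('D_s (omega_in (chart_at p)) (cmap (chart_at p) p)) v w
  = - bil ('D_s (omega_in (chart_at p)) (cmap (chart_at p) p)) w v.
Proof.
have dW := omega_in_differentiable p.
have E : ('D_s (omega_in (chart_at p)) (cmap (chart_at p) p))^T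
   = - 'D_s (omega_in (chart_at p)) (cmap (chart_at p) p).
  apply: etrans (esym (derive_trmx s dW)) _.
  rewrite (@near_eq_derive _ _ _ _ (- omega_in (chart_at p))).
    exact: deriveN (diff_derivable dW).
  apply: near_chart_at => y cy; apply: omega_in_skew => //.
  exact: chart_at_atlas.
by rewrite -bil_tr E -scaleN1r bil_scalemx mulN1r.
Qed.

Lemma dir_der_omega p U Y Z s : U p -> smooth_vec U Y -> smooth_vec U Z ->
  dir_der (fun q => bil (g q) (endo_app J Y q) (Z q)) p s
  = bil ('D_s (omega_in (chart_at p)) (cmap (chart_at p) p)) (Y p) (Z p)
    + kahler_form g J p
        ('D_s (vec_in (chart_at p) Y) (cmap (chart_at p) p)) (Z p)
    + kahler_form g J p (Y p)
        ('D_s (vec_in (chart_at p) Z) (cmap (chart_at p) p)).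
Proof.
move=> Up sY sZ.
have dW := omega_in_differentiable p.
have dY := vec_in_differentiable Up sY.
have dZ := vec_in_differentiable Up sZ.
have dYW := differentiable_mulmx dY dW.
have dZT := differentiable_trmx dZ.
have dYWZ := differentiable_mulmx dYW dZT.
rewrite /dir_der.
set c := chart_at p in dW dY dZ dYW dZT dYWZ *.
pose h y := vec_in c Y y *m omega_in c y *m (vec_in c Z y)^T.
rewrite (@near_eq_derive _ _ _ _ (fun y => h y 0 0 : R)); last first.
  apply: near_chart_at => y cy.
  have ac : atlas c := chart_at_atlas p.
  by rewrite /= -[RHS]/(bil (omega_in c y) _ _) omega_inE.
apply: etrans (esym (derive_mxE s 0 0 dYWZ)) _.
have -> := derive_mulmx s dYW dZT.
have -> := derive_mulmx s dY dW.
have -> := derive_trmx s dZ.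
rewrite -!omega_in_chart_at -/c !vec_in_chart_at.
move: ('D_s (vec_in c Y) _) ('D_s (omega_in c) _) ('D_s (vec_in c Z) _).
move: (omega_in c _) => W DY DW DZ.
by rewrite /bil mulmxDl !mxE [in RHS]addrAC [in RHS]addrC; ring.
Qed.

End FundamentalForm.

Section NearlyKahlerType.
Context {R : realType} {n : nat} {M : manifold R n} {g J : mxfield M}.
Context {nabla : vfield M -> vfield M -> vfield M}.
Hypothesis gJ : almost_hermitian g J.
Hypothesis LC : levi_civita g nabla.
Hypothesis NK : nearly_kahler_cond nabla J.
Implicit Types (X Y Z : vfield M) (p q : M) (U : set M) (c : chart R n M).

Let conn : affine_connection nabla. Proof. by case: LC. Qed.
Let torsion : torsion_free nabla. Proof. by case: LC. Qed.
Let metric : metric_connection g nabla. Proof. by case: LC. Qed.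
Let smooth_J : smooth_endo J. Proof. by case: gJ => _ []. Qed.
Let JJ p : J p *m J p = - 1%:M. Proof. by case: gJ => _ []. Qed.
Let g_J p v w : bil (g p) (v *m J p) (w *m J p) = bil (g p) v w.
Proof. by case: gJ. Qed.

(** (nabla_X omega)(Y, Z). *)
Definition nabla_omega X Y Z p : R :=
  bil (g p) (cov_der_endo nabla J X Y p) (Z p).

Let omega_d p :=
  ext_d (omega_in (g := g) (J := J) (chart_at p)) (cmap (chart_at p) p).

(** The difference between the flat connection of the chart at p and nabla: up
   to sign, the Christoffel symbols. *)
Let conn_defect X Y p :=
  'D_(X p) (vec_in (chart_at p) Y) (cmap (chart_at p) p) - nabla X Y p.

(** Both connections have no torsion. *)
Lemma conn_defect_sym p U X Y :
  open U -> U p -> smooth_vec U X -> smooth_vec U Y ->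
  conn_defect X Y p = conn_defect Y X p.
Proof.
move=> oU Up sX sY; have := torsion oU sX sY Up.
rewrite /lie_bracket /conn_defect.
move: ('D_(X p) _ _) ('D_(Y p) _ _) (nabla X Y p) (nabla Y X p) => a b r s E.
have -> : a = r - s + b by rewrite E subrK.
by rewrite addrAC [r - s]addrC addrK addrC.
Qed.

(** The metric property of nabla, applied to JY and Z, compared with the
   product rule in the chart.  The Christoffel terms cancel in the cyclic sum
   over X, Y, Z. *)
Lemma nabla_omegaE p U X Y Z : open U -> U p ->
  smooth_vec U X -> smooth_vec U Y -> smooth_vec U Z ->
  nabla_omega X Y Z p
  = bil ('D_(X p) (omega_in (g := g) (J := J) (chart_at p))
           (cmap (chart_at p) p)) (Y p) (Z p)
    + kahler_form g J p (conn_defect X Y p) (Z p)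
    - kahler_form g J p (conn_defect X Z p) (Y p).
Proof.
move=> oU Up sX sY sZ.
have sJY := smooth_vec_endo_app oU smooth_J sY.
have := metric oU sX sJY sZ Up.
rewrite (dir_der_omega gJ (X p) Up sY sZ).
rewrite /nabla_omega /cov_der_endo /conn_defect.
move: ('D__ (omega_in _) _) ('D__ (vec_in _ Y) _) ('D__ (vec_in _ Z) _).
move=> DW DY DZ.
rewrite bilBl -[bil (g p) (endo_app J (nabla X Y) p) _]
  /(kahler_form g J p (nabla X Y p) (Z p)).
rewrite -[bil (g p) (endo_app J Y p) _]/(kahler_form g J p (Y p) _).
have KB a b z : kahler_form g J p (a - b) z
    = kahler_form g J p a z - kahler_form g J p b z.
  by rewrite /kahler_form mulmxBl bilBl.
rewrite !KB (kahler_form_skew gJ p DZ) (kahler_form_skew gJ p (nabla X Z p)).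
lra.
Qed.

Lemma nabla_omega_skew23 p U X Y Z : open U -> U p ->
  smooth_vec U X -> smooth_vec U Y -> smooth_vec U Z ->
  nabla_omega X Y Z p = - nabla_omega X Z Y p.
Proof.
move=> oU Up sX sY sZ; rewrite !(nabla_omegaE (U := U))//.
rewrite (derive_omega_skew gJ); ring.
Qed.

(** Polarization of (nabla_X J) X = 0, applied to X + Y. *)
Lemma nabla_omega_skew12 p U X Y Z : open U -> U p ->
  smooth_vec U X -> smooth_vec U Y -> smooth_vec U Z ->
  nabla_omega X Y Z p = - nabla_omega Y X Z p.
Proof.
move=> oU Up sX sY sZ.
have cov_add X' Y' Y'' :
    smooth_vec U X' -> smooth_vec U Y' -> smooth_vec U Y'' ->
    cov_der_endo nabla J X' (fun q => Y' q + Y'' q) p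
    = cov_der_endo nabla J X' Y' p + cov_der_endo nabla J X' Y'' p.
  move=> sX' sY' sY''; rewrite /cov_der_endo.
  have -> : endo_app J (fun q => Y' q + Y'' q)
      = (fun q => endo_app J Y' q + endo_app J Y'' q).
    by apply/funext => q; rewrite /endo_app mulmxDl.
  have sJ Z' : smooth_vec U Z' -> smooth_vec U (endo_app J Z').
    exact: smooth_vec_endo_app.
  rewrite (conn_additive conn oU)//; try exact: sJ.
  rewrite {3 4 5}/endo_app (conn_additive conn oU)//.
  by rewrite mulmxDl opprD addrACA.
have cov_addl X' X'' Y' :
    smooth_vec U X' -> smooth_vec U X'' -> smooth_vec U Y' ->
    cov_der_endo nabla J (fun q => X' q + X'' q) Y' p
    = cov_der_endo nabla J X' Y' p + cov_der_endo nabla J X'' Y' p.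
  move=> sX' sX'' sY'; rewrite /cov_der_endo.
  have lin Z' : smooth_vec U Z' -> nabla (fun q => X' q + X'' q) Z' p
      = nabla X' Z' p + nabla X'' Z' p.
    move=> sZ'.
    have := conn_linear conn oU (smooth_fun_cst U 1) sX' sX'' sZ' Up.
    rewrite scale1r => <-; congr (nabla _ _ _).
    by apply/funext => q; rewrite scale1r.
  rewrite lin; last exact: smooth_vec_endo_app.
  by rewrite {2 3 4}/endo_app lin// mulmxDl opprD addrACA.
have sXY := smooth_vec_add oU sX sY.
have := NK oU sXY Up.
rewrite cov_addl// !cov_add// (NK oU sX Up) (NK oU sY Up) add0r addr0.
move=> /addr0_eq E; rewrite /nabla_omega.
by rewrite -E bilNl opprK.
Qed.

Lemma nabla_omega_ext_d p U X Y Z : open U -> U p ->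
  smooth_vec U X -> smooth_vec U Y -> smooth_vec U Z ->
  3 * nabla_omega X Y Z p = omega_d p (X p) (Y p) (Z p).
Proof.
move=> oU Up sX sY sZ.
have E1 : nabla_omega X Y Z p = nabla_omega Y Z X p.
  by rewrite (nabla_omega_skew12 oU Up)// (nabla_omega_skew23 oU Up)// opprK.
have E2 : nabla_omega Y Z X p = nabla_omega Z X Y p.
  by rewrite (nabla_omega_skew12 oU Up)// (nabla_omega_skew23 oU Up)// opprK.
have -> : 3 * nabla_omega X Y Z p
   = nabla_omega X Y Z p + nabla_omega Y Z X p + nabla_omega Z X Y p.
  by rewrite -E2 -E1; ring.
rewrite !(nabla_omegaE oU Up)// /omega_d /ext_d.
rewrite (conn_defect_sym oU Up sY sX) (conn_defect_sym oU Up sZ sX).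
rewrite (conn_defect_sym oU Up sZ sY).
ring.
Qed.

(** nabla_X J anticommutes with J, which comes from nabla_X (J (J Y)) =
   - nabla_X Y, and J is orthogonal. *)
Lemma nabla_omega_J23 p U X Y Z : open U -> U p ->
  smooth_vec U X -> smooth_vec U Y -> smooth_vec U Z ->
  nabla_omega X (endo_app J Y) (endo_app J Z) p = - nabla_omega X Y Z p.
Proof.
move=> oU Up sX sY sZ.
have JJY : endo_app J (endo_app J Y) = (fun q => - Y q).
  by apply/funext => q; rewrite /endo_app -mulmxA JJ mulmxN mulmx1.
have sNY : smooth_vec U (fun q => - Y q).
  by rewrite -JJY; do 2!apply: smooth_vec_endo_app => //.
have nabla0 : nabla X (fun=> 0) p = 0.
  have s0 := @smooth_vec0 _ _ M U.
  have := conn_additive conn oU sX s0 s0 Up.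
  have -> : (fun _ : M => 0 + 0) = (fun=> 0 : 'rV[R]_n).
    by apply/funext => q; rewrite addr0.
  by rewrite -[LHS]addr0 => /addrI.
have nablaN : nabla X (fun q => - Y q) p = - nabla X Y p.
  have := conn_additive conn oU sX sY sNY Up.
  have -> : (fun q => Y q - Y q) = (fun=> 0).
    by apply/funext => q; rewrite subrr.
  by rewrite nabla0 => /esym/addr0_eq.
rewrite /nabla_omega /cov_der_endo JJY nablaN /endo_app.
rewrite !bilBl g_J bilNl -[in RHS](g_J p (nabla X Y p *m _)) -mulmxA JJ.
by rewrite mulmxN mulmx1 bilNl; ring.
Qed.

End NearlyKahlerType.

(** * Non-integrability *)

Section NonIntegrability.
Context {R : realType} {n : nat} {M : manifold R n} {g J I : mxfield M}.
Implicit Types (p : M) (u v w : 'rV[R]_n).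

Local Notation omega_d p :=
  (ext_d (omega_in (g := g) (J := J) (chart_at p)) (cmap (chart_at p) p)).

(** The properties of nabla omega on coordinate fields, whose values at p are
   arbitrary; the pairs of slots are exchanged by skewness. *)
Lemma nearly_kahler_ext_d_type30 p nabla :
  almost_hermitian g J -> levi_civita g nabla -> nearly_kahler_cond nabla J ->
  [/\ forall u v w, omega_d p (u *m J p) (v *m J p) w = - omega_d p u v w,
      forall u v w, omega_d p (u *m J p) v (w *m J p) = - omega_d p u v w &
      forall u v w, omega_d p u (v *m J p) (w *m J p) = - omega_d p u v w].
Proof.
move=> gJ LC NK; have sJ : smooth_endo J by case: gJ => _ [].
have ap := chart_at_atlas p; have dp := chart_at_dom p.
have oU : open (cdom (chart_at p)) by exact: cdom_open.
have sF u : smooth_vec (cdom (chart_at p)) (chart_field (chart_at p) u).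
  exact: smooth_chart_field.
have E := nabla_omega_ext_d gJ LC NK oU dp.
have skew12 u v w : omega_d p u v w = - omega_d p v u w.
  have := nabla_omega_skew12 gJ LC NK oU dp (sF u) (sF v) (sF w).
  have := E _ _ _ (sF u) (sF v) (sF w); have := E _ _ _ (sF v) (sF u) (sF w).
  rewrite !chart_field_at => <- <- ->; ring.
have skew23 u v w : omega_d p u v w = - omega_d p u w v.
  have := nabla_omega_skew23 gJ LC oU dp (sF u) (sF v) (sF w).
  have := E _ _ _ (sF u) (sF v) (sF w); have := E _ _ _ (sF u) (sF w) (sF v).
  rewrite !chart_field_at => <- <- ->; ring.
have J23 u v w : omega_d p u (v *m J p) (w *m J p) = - omega_d p u v w.
  have sJF v' := smooth_vec_endo_app oU sJ (sF v').
  have := nabla_omega_J23 gJ LC oU dp (sF u) (sF v) (sF w).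
  have := E _ _ _ (sF u) (sF v) (sF w); have := E _ _ _ (sF u) (sJF v) (sJF w).
  rewrite /endo_app !chart_field_at -/(endo_app J _) => <- <- ->; ring.
split=> [u v w|u v w|]; last exact: J23.
- by rewrite skew23 skew12 J23 -skew12 -skew23.
- by rewrite skew12 J23 -skew12.
Qed.

(** Where (nabla_X J) Y is a nonzero vector z, the value of nabla omega on
   X, Y, z is g(z, z) > 0. *)
Lemma strictly_nearly_kahler_ext_d_neq0 p nabla v :
  almost_hermitian g J -> levi_civita g nabla -> nearly_kahler_cond nabla J ->
  strictness_cond nabla J -> v != 0 ->
  exists u w, omega_d p v u w != 0.
Proof.
move=> gJ LC NK strict v0.
have [U [X [Y [oU Up sX sY [Xp]]]]] := strict p v v0.
set z := cov_der_endo _ _ _ _ _ => z0.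
exists (Y p), z.
have ap := chart_at_atlas p; have dp := chart_at_dom p.
pose V := U `&` cdom (chart_at p).
have oV : open V by apply: openI => //; exact: cdom_open.
have sV (W : set M) (F : vfield M) :
    V `<=` W -> smooth_vec W F -> smooth_vec V F.
  move=> VW sF c ac; apply: smooth_on_sub (sF c ac) => x [cx Vx].
  by split=> //; exact: VW.
have sXV : smooth_vec V X by apply: sV sX => q [].
have sYV : smooth_vec V Y by apply: sV sY => q [].
have sZV : smooth_vec V (chart_field (chart_at p) z).
  by apply: (sV (cdom (chart_at p))) => [q []//|]; exact: smooth_chart_field.
have := nabla_omega_ext_d gJ LC NK oV (conj Up dp : V p) sXV sYV sZV.
rewrite Xp chart_field_at => <-.
rewrite mulf_neq0 ?pnatr_eq0//.
rewrite /nabla_omega chart_field_at gt_eqF//.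
by have [_] := metric_posdef gJ p; apply.
Qed.

Lemma tamed_integrable_ext_d_type21 p :
  almost_hermitian g J -> A_plus_omega g J I -> integrable_acs I ->
  forall u v w, omega_d p u v w
    = omega_d p (u *m I p) (v *m I p) w + omega_d p (u *m I p) v (w *m I p)
      + omega_d p u (v *m I p) (w *m I p).
Proof.
move=> gJ [[sI II] _ Iomega _] integ u v w.
have ap := chart_at_atlas p.
rewrite -[I p]endo_in_chart_at.
apply: ext_d_type21.
- exact: endo_in_differentiable.
- exact: (omega_in_differentiable gJ p).
- by apply: near_chart_at => y cy; exact: endo_in_sqr.
- move=> a b; rewrite !omega_in_chart_at; exact: kahler_form_skew.
- apply: near_chart_at => y cy; apply: bil_inj => a b.
  rewrite bil_mulmxr bil_mulmx.
  have -> := omega_in_bil (g := g) (J := J) a b ap cy.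
  rewrite -Iomega -[a in RHS](vec_in_chart_field a ap cy).
  rewrite -[b in RHS](vec_in_chart_field b ap cy) -!vec_in_endo_app//.
  by rewrite omega_inE.
- by move=> a b; exact: integrable_nijenhuis_coord.
Qed.

Lemma tamed_not_integrable p v : v != 0 ->
  strictly_nearly_kahler g J -> A_plus_omega g J I -> ~ integrable_acs I.
Proof.
move=> v0 [gJ [nabla [LC NK strict]]] tamed integ.
have [u [w /eqP]] := strictly_nearly_kahler_ext_d_neq0 p gJ LC NK strict v0.
apply.
have [J12 J13 J23] := nearly_kahler_ext_d_type30 p gJ LC NK.
have I21 := tamed_integrable_ext_d_type21 p gJ tamed integ.
have [[_ II] _ Iomega Itame] := tamed.
have [[_ _ _] [_ JJ] g_J] := gJ.
have Dlin := ext_d_trilinear (omega_in_differentiable gJ p).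
exact: (type30_type21_eq0 (metric_posdef gJ p) (JJ p) (g_J p) (II p) (Iomega p)
  (Itame p) Dlin J12 J13 J23 I21).
Qed.

End NonIntegrability.

Theorem mainTheorem1 (R : realType) (M : manifold R 6) (g J I : mxfield M)
    (M_nonempty : [set: M] !=set0)
    (gJ_snk : strictly_nearly_kahler g J)
    (I_tamed : A_plus_omega g J I) :
  ~ integrable_acs I.
Proof.
have [p _] := M_nonempty.
apply: (tamed_not_integrable p (v := delta_mx 0 0)) gJ_snk I_tamed.
by apply/eqP => /matrixP/(_ 0 0)/eqP; rewrite !mxE !eqxx oner_eq0.
Qed.
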